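(* Let $\phi\colon A\to B$ be a radical-preserving homomorphism of left artinian rings with superfluous kernel. Then $$\mathsf{fin.dim}\,A\le \mathsf{fin.dim}\,B+\mathsf{pd}\,B_A,$$ and the inequality remains valid if $\mathsf{fin.dim}$ is replaced (on both sides) with $\mathsf{Fin.dim}$ or with $\mathsf{gl.dim}$.
   Context: Rings are associative with unit, and homomorphisms are unital. $J(R)$ is the Jacobson radical of $R$. A ring homomorphism $\phi\colon A\to B$ is radical-preserving if $\phi(J(A))\subseteq J(B)$; its kernel is called superfluous if $\mathrm{Ker}\,\phi\subseteq J(A)$. $\mathsf{pd}\,B_A$ is the projective dimension of $B$ as a right $A$-module via restriction of scalars along $\phi$ (possibly $\infty$). $\mathsf{fin.dim}\,R$ (resp. $\mathsf{Fin.dim}\,R$) is the supremum of the projective dimensions of finitely generated (resp. all) left $R$-modules of finite projective dimension; $\mathsf{gl.dim}\,R$ is the left global dimension. *)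

(* Defs.v *)
From HB Require Import structures.
From mathcomp Require Import all_boot all_order all_algebra.
From mathcomp Require Import boolp classical_sets constructive_ereal.

Set Implicit Arguments.
Unset Strict Implicit.
Unset Printing Implicit Defensive.

Import GRing.Theory.
Local Open Scope classical_set_scope.
Local Open Scope ring_scope.

(* Rings are [pzRingType] (the zero ring is allowed), left R-modules are
   [lmodType R], right R-modules are [lmodType R^c]; the left ideals of R are
   the submodules of the regular module [R^o]. *)

Definition maximal_left_ideal (R : pzRingType) (I : {pred R^o}) : Prop :=
  [/\ submod_closed I, 1 \notin I &
      forall K : {pred R^o}, submod_closed K -> {subset I <= K} ->
        1 \notin K -> K =i I].

Definition jacobson_radical (R : pzRingType) : set R :=
  [set x | forall I : {pred R^o}, maximal_left_ideal I -> x \in I].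
Arguments jacobson_radical R : clear implicits.

Definition left_artinian (R : pzRingType) : Prop :=
  forall I : nat -> {pred R^o},
    (forall n, submod_closed (I n)) ->
    (forall n, {subset I n.+1 <= I n}) ->
    exists n, forall m, (n <= m)%N -> I m =i I n.

Definition radical_preserving (A B : pzRingType) (phi : {rmorphism A -> B}) :
    Prop :=
  phi @` jacobson_radical A `<=` jacobson_radical B.

Definition superfluous_kernel (A B : pzRingType) (phi : {rmorphism A -> B}) :
    Prop :=
  phi @^-1` [set 0] `<=` jacobson_radical A.

Definition finitely_generated (R : pzRingType) (M : lmodType R) : Prop :=
  exists n (g : 'I_n -> M), forall x : M,
    exists c : 'I_n -> R, x = \sum_i c i *: g i.

Definition projective_module (R : pzRingType) (P : lmodType R) : Prop :=
  forall (M N : lmodType R) (g : {linear M -> N}) (f : {linear P -> N}),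
    range g = [set: N] -> exists h : {linear P -> M}, g \o h =1 f.

(* 0 -> P_n -> ... -> P_1 -> P_0 -> M -> 0, extended by P_i = 0 for i > n. *)
Definition projective_resolution (R : pzRingType) (M : lmodType R) (n : nat)
    (P : nat -> lmodType R) (d : forall i, {linear P i.+1 -> P i})
    (eps : {linear P 0%N -> M}) : Prop :=
  [/\ forall i, projective_module (P i),
      forall i, (n < i)%N -> [set: P i] = [set 0],
      range eps = [set: M],
      range (d 0%N) = eps @^-1` [set 0] &
      forall i, range (d i.+1) = d i @^-1` [set 0]].

Definition has_projective_resolution (R : pzRingType) (M : lmodType R)
    (n : nat) : Prop :=
  exists (P : nat -> lmodType R) (d : forall i, {linear P i.+1 -> P i})
         (eps : {linear P 0%N -> M}), projective_resolution n d eps.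

(* Homological dimensions take their values in {0, 1, 2, ...} U {+oo}, viewed
   inside [\bar int]; the infimum of the empty set of lengths is +oo, and the
   zero module has projective dimension 0. *)
Definition pd (R : pzRingType) (M : lmodType R) : \bar int :=
  infimum +oo%E [set (n%:Z)%:E%E | n in has_projective_resolution M].

(* The default value 0 of [supremum] is irrelevant: the zero module belongs to
   each of the three families. *)
Definition fin_dim (R : pzRingType) : \bar int :=
  supremum 0%E [set e | exists M : lmodType R,
    [/\ finitely_generated M, (pd M < +oo)%E & e = pd M]].

Definition Fin_dim (R : pzRingType) : \bar int :=
  supremum 0%E [set e | exists M : lmodType R, (pd M < +oo)%E /\ e = pd M].

Definition gl_dim (R : pzRingType) : \bar int :=
  supremum 0%E [set e | exists M : lmodType R, e = pd M].

(* B as a right A-module, b . a = b * phi a. *)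
Definition right_restriction (A B : pzRingType) (phi : {rmorphism A -> B}) :
  Type := B.

Section RightRestriction.
Variables (A B : pzRingType) (phi : {rmorphism A -> B}).
Local Notation B_A := (right_restriction phi).

HB.instance Definition _ := GRing.Zmodule.copy B_A B.

Definition right_restriction_scale (a : A^c) (b : B_A) : B_A :=
  (b : B) * phi a.

Fact right_restriction_scaleA (a a' : A^c) (b : B_A) :
  right_restriction_scale a (right_restriction_scale a' b) =
  right_restriction_scale (a * a') b.
Proof. by rewrite /right_restriction_scale -mulrA -rmorphM. Qed.

Fact right_restriction_scale1 : left_id (1 : A^c) right_restriction_scale.
Proof. by move=> b; rewrite /right_restriction_scale rmorph1 mulr1. Qed.

Fact right_restriction_scaleDr :
  right_distributive right_restriction_scale +%R.
Proof. by move=> a b b'; apply: mulrDl. Qed.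

Fact right_restriction_scaleDl (b : B_A) :
  {morph right_restriction_scale^~ b : a a' / a + a'}.
Proof. by move=> a a'; rewrite /right_restriction_scale rmorphD mulrDr. Qed.

HB.instance Definition _ := GRing.Zmodule_isLmodule.Build A^c B_A
  right_restriction_scaleA right_restriction_scale1
  right_restriction_scaleDr right_restriction_scaleDl.

End RightRestriction.

(* Main.v *)
From HB Require Import structures.
Require Import Defs.
From mathcomp Require Import all_boot all_order all_algebra.
From mathcomp Require Import boolp classical_sets constructive_ereal.

(** Let [n] be the projective dimension of [B] as a right [A]-module, finite
    without loss of generality. To every left [A]-module [M] the proof attaches
    the left [B]-module [N], the base change to [B] of the [n]-th syzygy of [M]
    in a free resolution, and shows that

      [pd_A M <= n + k] if and only if [pd_B N <= k], for every [k]

    (lemma [pd_le_base_change]). Hence [pd M <= pd N + n], the dimension of [N]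
    is finite when that of [M] is, and [N] is finitely generated when [M] is,
    because [A] is left noetherian ([finitely_generated_submodule]). Taking
    suprema over [M] gives the three inequalities.

    Tensoring the resolution with [B] keeps it exact in the degrees above [n]
    ([pd_le_tensor_exact]: this is the vanishing of the groups
    [Tor_i^A (B, M)] for [i > n], by dimension shifting in [B]). In those
    degrees the base changes of the syzygies of [M] are therefore the syzygies
    of [N], and since the projective dimension can be read off from the syzygies
    of any projective resolution ([pd_le_syzygy], a form of Schanuel's lemma),
    it remains to see that, in degrees at least [n], a syzygy of [M] is
    projective exactly when its base change is.

    One direction is formal ([projective_base_change]). For the other
    ([projective_base_change_reflect]) minimal resolutions are replaced by a
    splitting criterion modulo the radical ([radical_injective_split]): the
    inclusion of a submodule [K] in a projective module [F] splits as soon as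
    the radical of [F] meets [K] in the radical of [K]. It rests on the
    existence of complements modulo the radical ([radical_complement]) and on
    the nilpotency of the radical ([jacobson_nilpotent]), both of which are
    properties of left artinian rings. The criterion can be tested after base
    change, because the hypotheses on [phi] give more than
    [phi (J(A)) <= J(B)]: the preimage of [J(B)] is exactly [J(A)]
    ([radical_reflecting]). *)

Set Implicit Arguments.
Unset Strict Implicit.
Unset Printing Implicit Defensive.

Import GRing.Theory.
Local Open Scope classical_set_scope.
Local Open Scope ring_scope.

(** * Submodules, quotients and factorizations *)

Lemma ex_linear (R : pzRingType) (U V : lmodType R) (f : U -> V) :
  linear f -> exists h : {linear U -> V}, h =1 f.
Proof.
move=> lf; pose m := GRing.isLinear.Build R U V *:%R f lf.
by pose h : {linear U -> V} := HB.pack f m; exists h.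
Qed.

Definition submodule (R : pzRingType) (V : lmodType R) (S : set V) : Prop :=
  S 0 /\ forall a u v, S u -> S v -> S (a *: u + v).

Section SubmoduleTheory.
Variables (R : pzRingType) (V : lmodType R) (S : set V).
Hypothesis hS : submodule S.

Lemma submod0 : S 0. Proof. exact: hS.1. Qed.

Lemma submodD u v : S u -> S v -> S (u + v).
Proof. by move=> Su Sv; rewrite -[u]scale1r; apply: hS.2. Qed.

Lemma submodZ a u : S u -> S (a *: u).
Proof.
by move=> Su; rewrite -[_ *: _]addr0; apply: hS.2 => //; apply: submod0.
Qed.

Lemma submodN u : S u -> S (- u).
Proof. by move=> Su; rewrite -scaleN1r; apply: submodZ. Qed.

Lemma submodB u v : S u -> S v -> S (u - v).
Proof. by move=> Su Sv; apply: submodD => //; apply: submodN. Qed.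

Lemma submod_sum (I : Type) (r : seq I) (P : pred I) (F : I -> V) :
  (forall i, P i -> S (F i)) -> S (\sum_(i <- r | P i) F i).
Proof. by move=> SF; apply: big_ind => //; [apply: submod0|apply: submodD]. Qed.

(** The proof that [S] is a submodule is a parameter of the type, so that the
    module structure built from it is inferred from the type. *)
Definition submodule_type & submodule S : Type := {x : V | S x}.

End SubmoduleTheory.

Section SubmoduleType.
Variables (R : pzRingType) (V : lmodType R) (S : set V) (hS : submodule S).
Local Notation T := (submodule_type hS).

HB.instance Definition _ := gen_eqMixin T.
HB.instance Definition _ := gen_choiceMixin T.

Let inj (u v : T) : proj1_sig u = proj1_sig v -> u = v.
Proof. by case: u v => [u Su] [v Sv] /= e; apply: eq_exist. Qed.

Let zero : T := exist _ 0 (submod0 hS).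
Let opp (u : T) : T := exist _ (- proj1_sig u) (submodN hS (proj2_sig u)).
Let add (u v : T) : T :=
  exist _ (proj1_sig u + proj1_sig v) (submodD hS (proj2_sig u) (proj2_sig v)).
Let scale (a : R) (u : T) : T :=
  exist _ (a *: proj1_sig u) (submodZ hS a (proj2_sig u)).

Fact submodule_type_addA : associative add.
Proof. by move=> u v w; apply: inj; apply: addrA. Qed.
Fact submodule_type_addC : commutative add.
Proof. by move=> u v; apply: inj; apply: addrC. Qed.
Fact submodule_type_add0 : left_id zero add.
Proof. by move=> u; apply: inj; apply: add0r. Qed.
Fact submodule_type_addN : left_inverse zero opp add.
Proof. by move=> u; apply: inj; apply: addNr. Qed.

HB.instance Definition _ := GRing.isZmodule.Build T submodule_type_addA
  submodule_type_addC submodule_type_add0 submodule_type_addN.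

Fact submodule_type_scaleA a b u : scale a (scale b u) = scale (a * b) u.
Proof. by apply: inj; apply: scalerA. Qed.
Fact submodule_type_scale1 : left_id 1 scale.
Proof. by move=> u; apply: inj; apply: scale1r. Qed.
Fact submodule_type_scaleDr : right_distributive scale +%R.
Proof. by move=> a u v; apply: inj; apply: scalerDr. Qed.
Fact submodule_type_scaleDl u : {morph scale^~ u : a b / a + b}.
Proof. by move=> a b; apply: inj; apply: scalerDl. Qed.

HB.instance Definition _ := GRing.Zmodule_isLmodule.Build R T
  submodule_type_scaleA submodule_type_scale1
  submodule_type_scaleDr submodule_type_scaleDl.

Lemma submodule_incl :
  exists2 i : {linear T -> V}, injective i & forall x, S x <-> exists u, i u = x.
Proof.
have [|i iE] := @ex_linear R T V (fun u => proj1_sig u); first by [].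
exists i => [u v|x]; first by rewrite !iE; apply: inj.
split=> [Sx|[u <-]]; first by exists (exist _ x Sx); rewrite iE.
by rewrite iE; case: u.
Qed.

End SubmoduleType.

Lemma ex_submodule (R : pzRingType) (V : lmodType R) (S : set V) :
  submodule S -> exists (T : lmodType R) (i : {linear T -> V}),
    injective i /\ forall x, S x <-> exists u, i u = x.
Proof. by move=> hS; have [i ii iS] := submodule_incl hS; eexists; exists i. Qed.

Definition quotient_type (R : pzRingType) (V : lmodType R) (S : set V)
  & submodule S : Type := {c : set V | exists x, c = [set y | S (y - x)]}.

Section QuotientType.
Variables (R : pzRingType) (V : lmodType R) (S : set V) (hS : submodule S).
Local Notation T := (quotient_type hS).

HB.instance Definition _ := gen_eqMixin T.
HB.instance Definition _ := gen_choiceMixin T.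

Let cls (x : V) : T := exist _ [set y | S (y - x)] (ex_intro _ x erefl).
Let rep (c : T) : V := sval (cid (proj2_sig c)).

Let repK c : cls (rep c) = c.
Proof.
by case: c => c hc; apply: eq_exist; rewrite /rep /=; case: cid => x /= ->.
Qed.

Let eq_cls x y : cls x = cls y <-> S (x - y).
Proof.
split=> [/(congr1 (fun c => proj1_sig c x)) /= <-|Sxy].
  by rewrite subrr; apply: submod0.
apply: eq_exist; apply/seteqP; split=> z /= Sz.
  by have := submodD hS Sz Sxy; rewrite addrA subrK.
by have := submodB hS Sz Sxy; rewrite opprB addrA subrK.
Qed.

Let zero : T := cls 0.
Let opp (c : T) : T := cls (- rep c).
Let add (c d : T) : T := cls (rep c + rep d).
Let scale (a : R) (c : T) : T := cls (a *: rep c).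

Let rep_cls x : S (rep (cls x) - x). Proof. exact/eq_cls. Qed.
Let clsN x : opp (cls x) = cls (- x).
Proof. by apply/eq_cls; rewrite -opprD; apply: (submodN hS); apply: rep_cls. Qed.
Let clsD x y : add (cls x) (cls y) = cls (x + y).
Proof.
by apply/eq_cls; rewrite opprD addrACA; apply: submodD => //; apply: rep_cls.
Qed.
Let clsZ a x : scale a (cls x) = cls (a *: x).
Proof. by apply/eq_cls; rewrite -scalerBr; apply: (submodZ hS); apply: rep_cls. Qed.

Fact quotient_type_addA : associative add.
Proof.
by move=> c d e; rewrite -(repK c) -(repK d) -(repK e) !clsD addrA.
Qed.
Fact quotient_type_addC : commutative add.
Proof. by move=> c d; rewrite /add addrC. Qed.
Fact quotient_type_add0 : left_id zero add.
Proof. by move=> c; rewrite -(repK c) clsD add0r. Qed.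
Fact quotient_type_addN : left_inverse zero opp add.
Proof. by move=> c; rewrite -(repK c) clsN clsD addNr. Qed.

HB.instance Definition _ := GRing.isZmodule.Build T quotient_type_addA
  quotient_type_addC quotient_type_add0 quotient_type_addN.

Fact quotient_type_scaleA a b c : scale a (scale b c) = scale (a * b) c.
Proof. by rewrite -(repK c) !clsZ scalerA. Qed.
Fact quotient_type_scale1 : left_id 1 scale.
Proof. by move=> c; rewrite -(repK c) clsZ scale1r. Qed.
Fact quotient_type_scaleDr : right_distributive scale +%R.
Proof.
move=> a c d; rewrite -(repK c) -(repK d).
by rewrite [cls _ + cls _]clsD !clsZ [RHS]clsD scalerDr.
Qed.
Fact quotient_type_scaleDl c : {morph scale^~ c : a b / a + b}.
Proof. by move=> a b; rewrite -(repK c) !clsZ [RHS]clsD scalerDl. Qed.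

HB.instance Definition _ := GRing.Zmodule_isLmodule.Build R T
  quotient_type_scaleA quotient_type_scale1
  quotient_type_scaleDr quotient_type_scaleDl.

Lemma quotient_proj :
  exists2 p : {linear V -> T},
    forall c, exists x, p x = c & forall x, p x = 0 <-> S x.
Proof.
have [|p pE] := @ex_linear R V T cls.
  by move=> a x y; rewrite -clsD -clsZ.
exists p => [c|x]; first by exists (rep c); rewrite pE.
by rewrite pE; split=> [/eq_cls|Sx]; [rewrite subr0|apply/eq_cls; rewrite subr0].
Qed.

End QuotientType.

Lemma ex_quotient (R : pzRingType) (V : lmodType R) (S : set V) :
  submodule S -> exists (T : lmodType R) (p : {linear V -> T}),
    (forall c, exists x, p x = c) /\ forall x, p x = 0 <-> S x.
Proof. by move=> hS; have [p ps pS] := quotient_proj hS; eexists; exists p. Qed.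

Section Factor.
Variables (R : pzRingType) (U V W : lmodType R).

Lemma factor_inj (i : {linear V -> W}) (g : {linear U -> W}) :
  injective i -> (forall x, exists v, i v = g x) ->
  exists h : {linear U -> V}, forall x, i (h x) = g x.
Proof.
move=> ii /choice[h hE]; have [|h' h'E] := @ex_linear R U V h.
  by move=> a x y; apply: ii; rewrite linearP !hE linearP.
by exists h' => x; rewrite h'E.
Qed.

Lemma factor_surj (p : {linear U -> V}) (g : {linear U -> W}) :
  (forall v, exists x, p x = v) -> (forall x, p x = 0 -> g x = 0) ->
  exists h : {linear V -> W}, forall x, h (p x) = g x.
Proof.
move=> /choice[s sE] pg.
have gE x y : p x = p y -> g x = g y.
  by move=> pxy; apply/eqP; rewrite -subr_eq0 -linearB pg // linearB pxy subrr.
have [|h hE] := @ex_linear R V W (g \o s).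
  by move=> a x y /=; rewrite -linearP; apply: gE; rewrite linearP !sE.
by exists h => x; rewrite hE /=; apply: gE; rewrite sE.
Qed.

End Factor.

Section LinearSets.
Variables (R : pzRingType) (U V : lmodType R) (f : {linear U -> V}).

Lemma submodule_image (S : set U) : submodule S -> submodule (f @` S).
Proof.
move=> hS; split; first by exists 0; [apply: submod0|rewrite linear0].
move=> a _ _ [u Su <-] [v Sv <-]; exists (a *: u + v); last by rewrite linearP.
exact: hS.2.
Qed.

Lemma submodule_ker : submodule [set u | f u = 0].
Proof.
split=> [|a u v] /=; first by rewrite linear0.
by rewrite linearP => -> ->; rewrite scaler0 addr0.
Qed.

Lemma submodule_range : submodule [set v | exists u, f u = v].
Proof.
split; first by exists 0; rewrite linear0.
by move=> a _ _ [u <-] [v <-]; exists (a *: u + v); rewrite linearP.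
Qed.

End LinearSets.

Definition sum_set (R : pzRingType) (V : lmodType R) (S T : set V) : set V :=
  [set x | exists s t, [/\ S s, T t & x = s + t]].

Lemma submodule_sum_set (R : pzRingType) (V : lmodType R) (S T : set V) :
  submodule S -> submodule T -> submodule (sum_set S T).
Proof.
move=> hS hT; split.
  by exists 0, 0; rewrite addr0; split=> //; apply: submod0.
move=> a _ _ [s [t [Ss Tt ->]]] [s' [t' [Ss' Tt' ->]]].
exists (a *: s + s'), (a *: t + t'); split; [exact: hS.2|exact: hT.2|].
by rewrite scalerDr addrACA.
Qed.

Lemma submodule_setI (R : pzRingType) (V : lmodType R) (S T : set V) :
  submodule S -> submodule T -> submodule (S `&` T).
Proof.
move=> hS hT; split; first by split; apply: submod0.
by move=> a u v [Su Tu] [Sv Tv]; split; [apply: hS.2|apply: hT.2].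
Qed.

Lemma submodule_cyclic (R : pzRingType) (V : lmodType R) (x : V) :
  submodule [set y | exists a : R, y = a *: x].
Proof.
split; first by exists 0; rewrite scale0r.
by move=> a _ _ [b ->] [c ->]; exists (a * b + c); rewrite scalerDl scalerA.
Qed.

(** Projectivity lifts linear choices as well as linear maps: the graph
    [T] of a linear relation is a module that projects onto [Q], and a section
    of this projection selects a related element linearly. *)
Lemma projective_select (R : pzRingType) (Q P : lmodType R)
    (T : set (Q * P)%type) :
  projective_module Q -> submodule T -> (forall q, exists p, T (q, p)) ->
  exists g : {linear Q -> P}, forall q, T (q, g q).
Proof.
move=> Qproj /ex_submodule[E [i [ii iT]]] Ttot.
have [|fst fstE] := @ex_linear R E Q (fun u => (i u).1).
  by move=> a u v; rewrite linearP.
have [|snd sndE] := @ex_linear R E P (fun u => (i u).2).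
  by move=> a u v; rewrite linearP.
have [|idQ idE] := @ex_linear R Q Q id; first by [].
have [|h hE] := Qproj E Q fst idQ.
  apply/seteqP; split=> // q _; have [p /iT[u ue]] := Ttot q.
  by exists u; rewrite // fstE ue.
exists (snd \o h : {linear Q -> P}) => q; apply/iT; exists (h q).
have := hE q; rewrite /= sndE idE fstE.
by case: (i (h q)) => a b /= ->.
Qed.

(** * Zorn's lemma and chain conditions for submodules *)

(** Zorn's lemma among the submodules between [S0] and a subset [D]; with [D]
    the complement of [1] these are the proper left ideals. *)
Lemma maximal_submodule_within (R : pzRingType) (V : lmodType R)
    (D S0 : set V) :
  submodule S0 -> S0 `<=` D ->
  exists S, [/\ submodule S, S0 `<=` S, S `<=` D &
    forall S', submodule S' -> S `<=` S' -> S' `<=` D -> S' `<=` S].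
Proof.
move=> hS0 S0D.
(* Adjoining S0 makes P hold of the union of the empty chain. *)
pose P (X : set V) := submodule (X `|` S0) /\ X `|` S0 `<=` D.
have [F FP Ftot|A [[hA AD] Amax]] := @Zorn_bigcup V P.
  split=> [|x [[X FX Xx]|]]; last exact: S0D; last by apply: (FP X FX).2; left.
  split=> [|a u v]; first by right; apply: submod0.
  have key X Y : F X -> F Y -> (X `|` S0) u -> (Y `|` S0) v ->
      (\bigcup_(Z in F) Z `|` S0) (a *: u + v).
    move=> FX FY Xu Yv; have [XY|YX] := Ftot X Y FX FY.
      have [|Zx|Sx] := (FP Y FY).1.2 a u v _ Yv.
      - by case: Xu => [/XY|]; [left|right].
      - by left; exists Y.
      - by right.
    have [|Zx|Sx] := (FP X FX).1.2 a u v Xu _.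
    - by case: Yv => [/YX|]; [left|right].
    - by left; exists X.
    - by right.
  case=> [[X FX Xu]|Su]; case=> [[Y FY Yv]|Sv].
  - exact: (key X Y FX FY (or_introl Xu) (or_introl Yv)).
  - exact: (key X X FX FX (or_introl Xu) (or_intror Sv)).
  - exact: (key Y Y FY FY (or_intror Su) (or_introl Yv)).
  - by right; apply: hS0.2.
exists (A `|` S0); split=> [//|x Sx|//|S' hS' AS' S'D x S'x]; first by right.
apply: contrapT => nAx; apply: (Amax S'); last first.
  have S'E : S' `|` S0 = S' by apply/setUidPl => y Sy; apply: AS'; right.
  by split; rewrite S'E.
split=> [y Ay|AS]; first by apply: AS'; left.
by apply: nAx; left; apply: AS.
Qed.

(** The chain condition is relative to an ambient subset [S], so that it can
    be proved by enlarging [S] one generator at a time. *)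
Definition dcc_in (R : pzRingType) (V : lmodType R) (S : set V) : Prop :=
  forall I : nat -> set V, (forall n, submodule (I n)) ->
    (forall n, I n `<=` S) -> (forall n, I n.+1 `<=` I n) ->
    exists n, forall m, (n <= m)%N -> I n `<=` I m.

Lemma decreasing_seq (T : Type) (I : nat -> set T) :
  (forall n, I n.+1 `<=` I n) -> forall n m, (n <= m)%N -> I m `<=` I n.
Proof.
move=> dI n m /subnK <-; elim: (m - n)%N => [|k IH] //.
by apply: subset_trans IH; rewrite addSn; apply: dI.
Qed.

Lemma dcc_min (R : pzRingType) (V : lmodType R) (S : set V)
    (F : set (set V)) :
  dcc_in S -> (forall L, F L -> submodule L /\ L `<=` S) -> F !=set0 ->
  exists2 L, F L & forall L', F L' -> L' `<=` L -> L `<=` L'.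
Proof.
move=> dccS FS [L0 FL0]; apply: contrapT => noMin.
have step (L : {L | F L}) : exists L' : {L | F L},
    sval L' `<=` sval L /\ ~ sval L `<=` sval L'.
  case: L => L FL; apply: contrapT => nstep; apply: noMin; exists L => //.
  move=> L' FL' L'L; apply: contrapT => nLL'.
  by apply: nstep; exists (exist _ L' FL').
have [f fE] := choice step.
pose I n := sval (iter n f (exist _ L0 FL0)).
have FI n : F (I n) by rewrite /I; case: (iter _ _ _).
have [||n /(_ n.+1 (leqnSn n))] := dccS I _ _ (fun n => (fE _).1).
- by move=> n; have [] := FS _ (FI n).
- by move=> n; have [] := FS _ (FI n).
exact: (fE _).2.
Qed.

(** * The Jacobson radical of a left artinian ring *)

Definition maximal_ideal (R : pzRingType) (m : set R^o) : Prop :=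
  [/\ submodule m, ~ m 1 &
      forall K : set R^o, submodule K -> m `<=` K -> ~ K 1 -> K `<=` m].

Lemma in_asboolP (T : Type) (S : set T) (x : T) :
  reflect (S x) (x \in (fun x : T => `[<S x>])).
Proof. exact: asboolP. Qed.

Lemma submodule_asbool (R : pzRingType) (V : lmodType R) (S : set V) :
  submodule S <-> submod_closed (fun x => `[<S x>]).
Proof.
split=> [[S0 Slin]|[/in_asboolP S0 Slin]].
  split=> [|a u v]; first exact/in_asboolP.
  by move=> /in_asboolP Su /in_asboolP Sv; apply/in_asboolP/Slin.
split=> // a u v /in_asboolP Su /in_asboolP Sv.
exact/in_asboolP/Slin.
Qed.

Lemma jacobsonP (R : pzRingType) (x : R) :
  jacobson_radical R x <-> forall m, maximal_ideal m -> m x.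
Proof.
split=> [Jx m [hm m1 mmax]|Jx I [hI I1 Imax]].
  apply/in_asboolP; apply: Jx; split; first exact: (@submodule_asbool R R^o m).1.
    exact/in_asboolP.
  move=> K hK mK K1 y; have hK' : submodule ([set` K] : set R^o).
    by split; [exact: hK.1|move=> a u v /=; apply: hK.2].
  apply/idP/in_asboolP => [Ky|my]; last by apply: mK; apply/in_asboolP.
  apply: (mmax [set` K]) => // [z mz|]; last exact/negP.
  by apply: mK; apply/in_asboolP.
apply: (Jx [set` I]); split=> [||K hK IK K1 y Ky].
- by split; [exact: hI.1|move=> a u v /=; apply: hI.2].
- exact/negP.
- rewrite /= -(Imax (fun x => `[<K x>])); first exact/in_asboolP.
  + exact: (@submodule_asbool R R^o K).1.
  + by move=> z Iz; apply/in_asboolP/IK.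
  + exact/in_asboolP.
Qed.

Lemma left_artinian_dcc (R : pzRingType) :
  left_artinian R -> dcc_in [set: R^o].
Proof.
move=> artR I hI _ dI.
have [||n nE] := artR (fun n x => `[<I n x>]).
- by move=> n; apply: (@submodule_asbool R R^o (I n)).1.
- by move=> n x /in_asboolP /dI Inx; apply/in_asboolP.
exists n => m nm x Inx.
by apply/in_asboolP; rewrite nE //; apply/in_asboolP.
Qed.

Section LeftIdeal.
Variables (R : pzRingType) (I : set R) (hI : submodule (I : set R^o)).

Lemma left_ideal0 : I 0. Proof. exact: hI.1. Qed.
Lemma left_idealD (x y : R) : I x -> I y -> I (x + y).
Proof. exact: (submodD hI). Qed.
Lemma left_idealB (x y : R) : I x -> I y -> I (x - y).
Proof. exact: (submodB hI). Qed.
Lemma left_idealM (a x : R) : I x -> I (a * x).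
Proof. exact: (submodZ hI). Qed.

End LeftIdeal.

Section JacobsonRadical.
Variable R : pzRingType.
Local Notation J := (jacobson_radical R).

Lemma jacobson_submodule : submodule (J : set R^o).
Proof.
split=> [|a u v /jacobsonP Ju /jacobsonP Jv]; apply/jacobsonP => m mm.
  by have [hm _ _] := mm; apply: submod0.
by have [hm _ _] := mm; apply: hm.2; [apply: Ju|apply: Jv].
Qed.

(** The annihilator of a nonzero element of the simple module [R / m] is
    again a maximal left ideal. *)
Lemma maximal_ideal_colon (m : set R^o) (a : R) :
  maximal_ideal m -> ~ m a -> maximal_ideal [set r | m (r * a)].
Proof.
move=> [hm m1 mmax] ma; have hc : submodule ([set r | m (r * a)] : set R^o).
  split=> [|r u v /=]; first by rewrite /= mul0r; exact: hm.1.
  have -> : (r *: u + v) * a = r * (u * a) + v * a by rewrite mulrDl mulrA.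
  exact: hm.2.
split=> [||K hK cK K1 k Kk] //=; first by rewrite mul1r.
apply: contrapT => mka; apply: K1.
pose L : set R^o := sum_set m [set y | exists r : R, y = r *: (k * a : R^o)].
have hL : submodule L by apply: submodule_sum_set => //; apply: submodule_cyclic.
have L1 : L 1.
  apply: contrapT => L1; apply: mka; apply: (mmax L) => // [x mx|].
    by exists x, 0; rewrite addr0; split=> //; exists 0; rewrite scale0r.
  exists 0, (k * a); rewrite add0r; split=> //; first exact: hm.1.
  by exists 1; rewrite scale1r.
have [x [_ [mx [r ->] xE]]] : L a by rewrite -[a]mulr1; apply: (submodZ hL).
have Krk : K (1 - r * k).
  by apply: cK => /=; rewrite mulrBl mul1r -mulrA {1}xE addrK.
by rewrite -(subrK (r * k) 1); apply: left_idealD => //; apply: left_idealM.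
Qed.

Lemma jacobson_mulr x a : J x -> J (x * a).
Proof.
move=> /jacobsonP Jx; apply/jacobsonP => m mm; have [hm _ _] := mm.
have [ma|nma] := pselect (m a); first exact: (left_idealM hm).
exact: (Jx _ (maximal_ideal_colon mm nma)).
Qed.

Lemma jacobson_mull a x : J x -> J (a * x).
Proof. exact: (left_idealM jacobson_submodule). Qed.

(** Otherwise the left ideal of [1 - x] lies in a maximal one, which contains
    [x] too. *)
Lemma jacobson_left_inverse x : J x -> exists u, u * (1 - x) = 1.
Proof.
move=> /jacobsonP Jx; apply: contrapT => nu.
have hI := @submodule_cyclic R R^o (1 - x).
have [|m [hm Im m1 mmax]] := @maximal_submodule_within R R^o [set y | y <> 1] _ hI.
  by move=> _ [u ->] ux; apply: nu; exists u.
have mm : maximal_ideal m.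
  split=> // [m1'|K hK mK K1]; first exact: m1 m1' _.
  by apply: mmax => // y Ky y1; apply: K1; rewrite -y1.
apply: (m1 1) => //; rewrite -(subrK x 1); apply: left_idealD => //.
  by apply: Im; exists 1; rewrite scale1r.
exact: Jx.
Qed.

(** Modulo the radical every left ideal is generated by an idempotent: the
    minimal supplement [L] of [I] meets [I] inside the radical, since a
    maximal left ideal that misses part of the intersection would cut out a
    smaller supplement; split [1] along the two ideals. *)
Lemma left_ideal_generator (I : set R^o) :
  left_artinian R -> submodule I ->
  exists2 e : R, I e & forall a : R, I a -> J (a - a * e).
Proof.
move=> artR hI.
pose F (L : set R^o) := submodule L /\ sum_set L I 1.
have [L [hL [l [e [Ll Ie le]]]] Lmin] :
    exists2 L, F L & forall L', F L' -> L' `<=` L -> L `<=` L'.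
  apply: (dcc_min (left_artinian_dcc artR)); first by move=> L [].
  exists setT; split; first by split.
  by exists 1, 0; rewrite addr0; split=> //; apply: left_ideal0.
exists e => // a Ia; have -> : a - a * e = a * l.
  by rewrite -[X in X - _]mulr1 le mulrDr addrK.
have Lal : L (a * l) by apply: (left_idealM hL).
have Ial : I (a * l).
  have -> : a * l = a - a * e by rewrite -[X in X - _]mulr1 le mulrDr addrK.
  by apply: left_idealB => //; apply: (left_idealM hI).
apply/jacobsonP => m [hm m1 mmax]; apply: contrapT => mal.
have hLI := submodule_setI hL hI.
have [y [z [my [Lz Iz] yz]]] : sum_set m (L `&` I) 1.
  apply: contrapT => n1; apply: mal; apply: (mmax (sum_set m (L `&` I))) => //.
  - exact: submodule_sum_set.
  - by move=> x mx; exists x, 0; rewrite addr0; split=> //; apply: left_ideal0.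
  - by exists 0, (a * l); rewrite add0r; split=> //; apply: left_ideal0.
suff LLm : L `<=` (L `&` m) by have [] := LLm _ Lal.
apply: Lmin; last by move=> x [].
split; first exact: submodule_setI.
exists (l * y), (l * z + e); split.
- have lyE : l * y = l - l * z by rewrite -[X in X - _]mulr1 yz mulrDr addrK.
  split; last exact: (left_idealM hm).
  by rewrite /= lyE; apply: left_idealB => //; apply: (left_idealM hL).
- by apply: left_idealD => //; apply: (left_idealM hI).
- by rewrite addrA -mulrDr -yz mulr1.
Qed.

End JacobsonRadical.

(** * Modules over a left artinian ring modulo the radical *)

Section MulSpan.
Variables (R : pzRingType) (I : set R).

(** The additive subgroup [I V] of [V], for an arbitrary set [I] of scalars. *)
Inductive mulspan (V : lmodType R) : V -> Prop :=
| mulspan0 : mulspan 0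
| mulspanD u v : mulspan u -> mulspan v -> mulspan (u + v)
| mulspanZ a v : I a -> mulspan (a *: v).

Lemma mulspan_submodule (V : lmodType R) :
  (forall a x, I x -> I (a * x)) -> submodule (mulspan (V := V)).
Proof.
move=> mulI; split=> [|a u v Iu Iv]; first exact: mulspan0.
apply: mulspanD => //; elim: Iu => [|{}u w _ IHu _ IHw|b w Ib].
- by rewrite scaler0; apply: mulspan0.
- by rewrite scalerDr; apply: mulspanD.
- by rewrite scalerA; apply/mulspanZ/mulI.
Qed.

Lemma mulspan_linear (V W : lmodType R) (f : {linear V -> W}) v :
  mulspan v -> mulspan (f v).
Proof.
elim=> [|{}v w _ IHv _ IHw|a w Ia].
- by rewrite linear0; apply: mulspan0.
- by rewrite linearD; apply: mulspanD.
- by rewrite linearZ; apply: mulspanZ.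
Qed.

End MulSpan.

Section Nilpotency.
Variable R : pzRingType.
Local Notation J := (jacobson_radical R).

Fixpoint radical_power (k : nat) : set R :=
  if k is k'.+1 then [set x | exists i j, [/\ radical_power k' i, J j & x = i * j]]
  else setT.

Lemma radical_power_mull k a x : radical_power k x -> radical_power k (a * x).
Proof.
elim: k a x => [|k IH] a x //= [i [j [ki Jj ->]]].
by exists (a * i), j; rewrite mulrA; split=> //; apply: IH.
Qed.

Lemma radical_power_mulr k a x : radical_power k x -> radical_power k (x * a).
Proof.
case: k => [|k] //= [i [j [ki Jj ->]]].
by exists i, (j * a); rewrite mulrA; split=> //; apply: jacobson_mulr.
Qed.

Lemma radical_power_dec k : radical_power k.+1 `<=` radical_power k.
Proof. by move=> _ [i [j [ki _ ->]]]; apply: radical_power_mulr. Qed.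

Lemma radical_powerD k l x :
  radical_power (k + l) x ->
  exists y z, [/\ radical_power k y, radical_power l z & x = y * z].
Proof.
elim: l x => [|l IH] x; first by rewrite addn0 => kx; exists x, 1; rewrite mulr1.
rewrite addnS => -[_ [j [/IH[y [z [ky lz ->]]] Jj ->]]].
by exists y, (z * j); rewrite mulrA; split=> //; exists z, j.
Qed.

Lemma mulspan_incl (I I' : set R) (V : lmodType R) (v : V) :
  I `<=` I' -> mulspan I v -> mulspan I' v.
Proof.
move=> II'; elim=> [|u w _ Iu _ Iw|a w /II' Ia].
- exact: mulspan0.
- exact: mulspanD.
- exact: mulspanZ.
Qed.

Lemma mulspan_radical_power k x :
  mulspan (V := R^o) (radical_power k.+1) x -> J x.
Proof.
elim=> [|u v _ Ju _ Jv|a v [i [j [_ Jj ->]]]].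
- exact: (left_ideal0 (@jacobson_submodule R)).
- exact: (left_idealD (@jacobson_submodule R)).
- by apply: jacobson_mulr; apply: jacobson_mull.
Qed.

(** The powers of the radical stabilize at a left ideal [K]. If [K] were
    nonzero, a minimal left ideal [L] with [K L] nonzero would be [K x] for
    some [x] in [L], so that [x = i x] with [i] in the radical, and [1 - i] is
    left invertible. *)
Lemma jacobson_nilpotent :
  left_artinian R -> exists k, forall x, radical_power k x -> x = 0.
Proof.
move=> artR; pose I n := mulspan (radical_power n.+1) (V := R^o).
have hI n : submodule (I n).
  by apply: mulspan_submodule => a x; apply: radical_power_mull.
have dI n : I n.+1 `<=` I n.
  by move=> x; apply: mulspan_incl; apply: radical_power_dec.
have [//|n nI] := left_artinian_dcc artR hI _ dI.
exists n.+1; apply: contrapT => nz.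
pose F (L : set R^o) := submodule L /\
  exists k l, [/\ radical_power n.+1 k, L l & k * l <> 0].
have [L [hL [k [x [nk Lx kx]]]] Lmin] :
    exists2 L, F L & forall L', F L' -> L' `<=` L -> L `<=` L'.
  apply: (dcc_min (left_artinian_dcc artR)); first by move=> L [].
  exists setT; split; first by split.
  apply: contrapT => nkl; apply: nz => k nk; apply: contrapT => k0.
  by apply: nkl; exists k, 1; rewrite mulr1.
pose L' : set R^o := [set y | exists2 i : R, I n i & y = i * x].
have LL' : L `<=` L'; last first.
  have [i Ii xE] := LL' _ Lx.
  have [u uE] := jacobson_left_inverse (mulspan_radical_power Ii).
  (* From x = i x, the invertibility of 1 - i gives x = 0. *)
  apply: kx; have -> : x = 0 :> R; last by rewrite mulr0.
  by rewrite -[LHS](mul1r (x : R)) -uE -mulrA mulrBl mul1r -xE subrr mulr0.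
apply: Lmin => [|_ [i _ ->]]; last exact: (left_idealM hL).
split.
  split=> [|a _ _ [i Ii ->] [j Ij ->]].
    by exists 0; [apply: submod0 (hI n)|rewrite mul0r].
  exists (a * i + j); last by rewrite mulrDl -mulrA.
  exact: (left_idealD (hI n) (left_idealM (hI n) a Ii) Ij).
apply: contrapT => nkl; apply: kx.
have /(nI (n + n.+1)%N (leq_addr _ _)) : I n k.
  by rewrite -[k]mulr1; apply: (mulspanZ (1 : R^o)).
elim=> [|u v _ ux _ vx|a v]; first by rewrite mul0r.
  by rewrite mulrDl ux vx addr0.
rewrite -addSn => /radical_powerD[y [z [ny nz' ->]]].
have -> : (y * z) *: v * x = y * (z * (v * x)) by rewrite !mulrA.
apply: contrapT => yz; apply: nkl; exists y, (z * v * x); split=> //.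
  exists (z * v) => //; exact: (mulspanZ (v : R^o)).
by rewrite -!mulrA.
Qed.

End Nilpotency.

Section RadicalOfModules.
Variable R : pzRingType.
Hypothesis artR : left_artinian R.
Local Notation J := (jacobson_radical R).

Lemma radical_submodule (V : lmodType R) : submodule (mulspan J (V := V)).
Proof. by apply: mulspan_submodule => a x; apply: jacobson_mull. Qed.

(** The [k]-th iterate of [h] takes its values in [J^k V]. *)
Lemma radical_endomorphism_nilpotent (V : lmodType R) (h : {linear V -> V}) :
  (forall v, mulspan J (h v)) -> exists k, forall v, iter k h v = 0.
Proof.
move=> hJ; have [k k0] := jacobson_nilpotent artR; exists k => v.
have : mulspan (radical_power k) (iter k h v).
  elim: (k) v => [|l IH] v; first by rewrite -[v]scale1r; apply: mulspanZ.
  rewrite iterS; elim: (IH v) => [|u w _ IHu _ IHw|i u li].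
  - by rewrite linear0; apply: mulspan0.
  - by rewrite linearD; apply: mulspanD.
  - rewrite linearZ /=; elim: (hJ u) => [|{}u w _ IHu _ IHw|j w Jj].
    + by rewrite scaler0; apply: mulspan0.
    + by rewrite scalerDr; apply: mulspanD.
    + by rewrite scalerA; apply: mulspanZ; exists i, j.
elim=> [//|u w _ -> _ ->|a w /k0 ->]; [exact: addr0|exact: scale0r].
Qed.

(** Inversion by the geometric series. *)
Lemma unipotent_left_inverse (V : lmodType R) (g : {linear V -> V}) :
  (forall v, mulspan J (v - g v)) ->
  exists s : {linear V -> V}, forall v, s (g v) = v.
Proof.
move=> gJ; have [|h hE] := @ex_linear R V V (fun v => v - g v).
  by move=> a u v; rewrite linearP opprD addrACA scalerBr.
have [v|k k0] := @radical_endomorphism_nilpotent V h; first by rewrite hE.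
suff [s sE] : exists s : {linear V -> V}, forall v, s (g v) = v - iter k h v.
  by exists s => v; rewrite sE k0 subr0.
elim: k {k0} => [|k [s sE]].
  have [|s sE] := @ex_linear R V V (fun => 0); last first.
    by exists s => v; rewrite sE subrr.
  by move=> a u v; rewrite scaler0 addr0.
have hP a u v : iter k h (a *: u + v) = a *: iter k h u + iter k h v.
  by elim: k {sE} => //= l ->; rewrite linearP.
have [|t tE] := @ex_linear R V V (fun v => s v + iter k h v).
  by move=> a u v; rewrite linearP hP addrACA scalerDr.
exists t => v; rewrite tE sE iterSr hE.
have -> : iter k h (v - g v) = iter k h v - iter k h (g v).
  by rewrite -!scaleN1r ![_ + -1 *: _]addrC hP.
by rewrite opprB addrAC addrA.
Qed.

(** Every submodule has a complement modulo the radical. A submodule [S] that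
    is maximal among those containing [J Q] and meeting [N] inside it works: for
    [q] in [Q], the left ideal of the [a] with [a q] in [S + N] has a generator [e]
    modulo the radical, and [S] absorbs [(1 - e) q]. *)
Lemma radical_complement (Q : lmodType R) (N : set Q) :
  submodule N -> exists S : set Q, [/\ submodule S, forall q, sum_set S N q &
    S `&` N `<=` mulspan J (V := Q)].
Proof.
move=> hN; have hJ := @radical_submodule Q.
have [x Jx _|S [hS JS SN Smax]] :=
  @maximal_submodule_within R Q [set x | N x -> mulspan J x] _ hJ; first by [].
exists S; split=> // [q|x [Sx Nx]]; last exact: SN.
have hSN := submodule_sum_set hS hN.
have hI : submodule ([set a | sum_set S N (a *: q)] : set R^o).
  split=> [|a b c /= Ib Ic]; first by rewrite /= scale0r; apply: submod0.
  by rewrite scalerDl -scalerA; apply: hSN.2.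
have [e Ie eP] := left_ideal_generator artR hI.
suff Sq : S ((1 - e) *: q).
  rewrite -[q]scale1r -(subrK e 1) scalerDl; apply: submodD => //.
  by exists ((1 - e) *: q), 0; rewrite addr0; split=> //; apply: submod0.
pose S' := sum_set S [set y | exists a : R, y = a *: ((1 - e) *: q)].
apply: (Smax S').
- by apply: submodule_sum_set => //; apply: submodule_cyclic.
- by move=> x Sx; exists x, 0; rewrite addr0; split=> //; exists 0; rewrite scale0r.
- move=> _ [s [_ [Ss [a ->] ->]]] /= Nx.
  suff Jaq : mulspan J (a *: ((1 - e) *: q)).
    by apply: SN => //; apply: submodD => //; apply: JS.
  have Ia : sum_set S N (a *: q).
    rewrite -[q]scale1r -(subrK e 1) scalerDl scalerDr.
    apply: submodD => //; last first.
      exact: submodZ.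
    exists (- s), (s + a *: ((1 - e) *: q)); rewrite addKr; split=> //.
    exact: submodN.
  by rewrite scalerA mulrBr mulr1; apply: mulspanZ; apply: eP.
- exists 0, ((1 - e) *: q); rewrite add0r; split=> //; first exact: submod0.
  by exists 1; rewrite scale1r.
Qed.

(** A map into a projective module that stays injective modulo the radical
    splits: a complement of its image yields a retraction modulo the radical,
    which unipotence corrects. *)
Lemma radical_injective_split (K Q : lmodType R) (i : {linear K -> Q}) :
  projective_module Q -> (forall x, mulspan J (i x) -> mulspan J x) ->
  exists u : {linear Q -> K}, forall x, u (i x) = x.
Proof.
move=> Qproj iJ.
have [|S [hS SiK SJ]] := @radical_complement Q [set y | exists x, i x = y].
  exact: submodule_range.
have [||g gE] := @projective_select R Q K [set p | S (p.1 - i p.2)] Qproj.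
- split=> [|a [q k] [q' k'] /= Sq Sq'].
    by rewrite /= linear0 subr0; apply: submod0.
  by rewrite linearP opprD addrACA -scalerBr; apply: hS.2.
- by move=> q; have [s [_ [Ss [k <-] ->]]] := SiK q; exists k; rewrite /= addrK.
have [x|s sE] := @unipotent_left_inverse K (g \o i : {linear K -> K}).
  apply: iJ; apply: SJ; split=> /=; last by exists (x - g (i x)).
  by rewrite linearB; apply: gE.
by exists (s \o g : {linear Q -> K}).
Qed.

End RadicalOfModules.

(** * Left artinian rings are left noetherian *)

Section Spans.
Variables (R : pzRingType) (V : lmodType R).

Fixpoint seq_span (s : seq V) : set V :=
  if s is x :: s' then sum_set [set y | exists a : R, y = a *: x] (seq_span s')
  else [set 0].

Lemma span_submodule s : submodule (seq_span s).
Proof.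
elim: s => [|x s IH] /=; last exact: submodule_sum_set (submodule_cyclic x) IH.
by split=> [//|a u v -> ->]; rewrite /= scaler0 addr0.
Qed.

Lemma span_sum (n : nat) (g : 'I_n -> V) (x : V) :
  seq_span (map g (enum 'I_n)) x <-> exists c : 'I_n -> R, x = \sum_i c i *: g i.
Proof.
have key (s : seq 'I_n) y : uniq s -> (seq_span (map g s) y <->
    exists c : 'I_n -> R, y = \sum_(i <- s) c i *: g i).
  elim: s y => [|i s IH] y /=.
    by move=> _; split=> [->|[c ->]]; [exists (fun=> 0)|]; rewrite big_nil.
  case/andP=> is_ us; split=> [[_ [t [[a ->] /IH - /(_ us) [c ->] ->]]]|[c ->]].
    exists (fun j => if j == i then a else c j); rewrite big_cons eqxx.
    congr (_ + _); apply: eq_big_seq => j js; case: eqP => // ji.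
    by rewrite -ji js in is_.
  rewrite big_cons; exists (c i *: g i), (\sum_(j <- s) c j *: g j); split=> //.
    by exists (c i).
  by apply/IH => //; exists c.
rewrite key ?enum_uniq //; split=> -[c ->]; exists c; by rewrite big_enum.
Qed.

Lemma finitely_generatedP :
  finitely_generated V <-> exists s, forall x, seq_span s x.
Proof.
split=> [[n [g gE]]|[s sE]].
  by exists (map g (enum 'I_n)) => x; apply/span_sum.
exists (size s), (tnth (in_tuple s)) => x; apply/span_sum.
by rewrite map_tnth_enum.
Qed.

(** Along a descending chain in the span of [x :: s], the coefficients of [x]
    form a descending chain of left ideals; once it is stationary, the chain is
    governed by its intersection with the span of [s]. *)
Lemma dcc_span s : left_artinian R -> dcc_in (seq_span s).
Proof.
move=> artR; elim: s => [|x s IH] I hI sI dI.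
  by exists 0%N => m _ y /sI ->; apply: submod0.
pose T n : set R^o := [set a | exists2 v, seq_span s v & I n (a *: x + v)].
have hs := span_submodule s.
have [|//||p pT] := left_artinian_dcc artR (I := T).
- move=> n; split=> [|a b c [u su Iu] [v sv Iv]].
    by exists 0; rewrite ?scale0r ?addr0; [apply: submod0|apply: submod0 (hI n)].
  exists (a *: u + v); first exact: hs.2.
  rewrite scalerDl addrACA -scalerA -scalerDr; exact: (hI n).2.
- by move=> n a [v sv Iv]; exists v => //; apply: dI.
have [|||q qI] := IH (fun n => I n `&` seq_span s).
- by move=> n; apply: submodule_setI.
- by move=> n y [].
- by move=> n y [/dI].
exists (maxn p q) => m; rewrite geq_max => /andP[pm qm] y Iy.
have [_ [v [[a ->] sv yE]]] := sI _ _ Iy.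
have [v' sv' Iv'] : T m a.
  apply: (pT m pm); exists v => //; rewrite -yE.
  exact: (decreasing_seq dI (leq_maxl p q)).
have [Imv _] : (I m `&` seq_span s) (v - v').
  apply: (qI m qm); split; last exact: submodB.
  have -> : v - v' = y - (a *: x + v').
    by rewrite yE opprD addrACA subrr add0r.
  apply: (submodB (hI q)); first exact: (decreasing_seq dI (leq_maxr p q)).
  exact: (decreasing_seq dI qm).
have -> : y = (a *: x + v') + (v - v').
  by rewrite addrACA subrr addr0 yE.
exact: (submodD (hI m)).
Qed.

End Spans.

(** Hopkins' theorem. In a minimal submodule [L] that is not finitely
    generated, pick [x] outside the radical of [L]; a complement of the cyclic
    module of [x] modulo the radical is a proper submodule, hence finitely
    generated, and together with [x] it generates [L]. *)
Lemma finitely_generated_submodule (R : pzRingType) (V : lmodType R)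
    (L : set V) :
  left_artinian R -> finitely_generated V -> submodule L ->
  exists s, L = seq_span s.
Proof.
move=> artR /finitely_generatedP[s0 s0V] hL; apply: contrapT => nL.
pose F (L : set V) := submodule L /\ ~ exists s, L = seq_span s.
have [||L' [hL' nL'] Lmin] := dcc_min (F := F) (dcc_span (s := s0) artR).
- by move=> K [hK _]; split.
- by exists L.
have [T [i [ii iL]]] := ex_submodule hL'.
have [x nJx] : exists x : T, ~ mulspan (jacobson_radical R) x.
  (* Otherwise the zero endomorphism of T is unipotent, so T vanishes. *)
  apply: contrapT => JT; apply: nL'; exists [::].
  apply/seteqP; split=> [y|y /= ->]; last exact: submod0.
  have [|z zE] := @ex_linear R T T (fun=> 0).
    by move=> a u v; rewrite scaler0 addr0.
  have [v|t tE] := @unipotent_left_inverse R artR T z.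
    by apply: contrapT => Jv; apply: JT; exists (v - z v).
  by move=> /iL[u <-]; rewrite -(tE u) zE !linear0.
have [S [hS Sx SJ]] := radical_complement artR (submodule_cyclic x).
have [s sE] : exists s, i @` S = seq_span s.
  apply: contrapT => ns; apply: nJx; apply: SJ; split=> /=; last first.
    by exists 1; rewrite scale1r.
  have [|||u Su /ii <- //] := Lmin (i @` S) _ _ (i x).
  - by split=> //; apply: submodule_image.
  - by move=> _ [u Su <-]; apply/iL; exists u.
  - by apply/iL; exists x.
apply: nL'; exists (i x :: s); apply/seteqP; split=> [_ /iL[u <-]|y].
  have [v [_ [Sv [a ->] ->]]] := Sx u; rewrite linearD linearZ addrC.
  by exists (a *: i x), (i v); split=> //; [exists a|rewrite -sE; exists v].
move=> [_ [w [[a ->] + ->]]]; rewrite -/(seq_span _) -sE => -[v Sv <-].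
by apply/iL; exists (a *: x + v); rewrite linearP.
Qed.

(** * Finitely supported functions and free modules *)

(** For a right [A]-module [K] this is the tensor product of [K] with the free
    left module on [X]; with [K] the ring itself it is that free module. *)
Definition finsupp (X : choiceType) (K : zmodType) : Type :=
  {f : X -> K | exists s : seq X, forall x, x \notin s -> f x = 0}.

Section FinsuppZmodule.
Variables (X : choiceType) (K : zmodType).
Local Notation T := (finsupp X K).

Definition fcoef (f : T) : X -> K := sval f.

Lemma finsupp_ext (f g : T) : fcoef f =1 fcoef g -> f = g.
Proof. by case: f g => [f sf] [g sg] /= /funext e; apply: eq_exist. Qed.

HB.instance Definition _ := gen_eqMixin T.
HB.instance Definition _ := gen_choiceMixin T.

Fact finsupp_zero_subproof :
  exists s : seq X, forall x, x \notin s -> (fun=> 0 : K) x = 0.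
Proof. by exists [::]. Qed.

Fact finsupp_opp_subproof (f : T) :
  exists s : seq X, forall x, x \notin s -> - fcoef f x = 0.
Proof. by case: f => f [s fs]; exists s => x /fs /= ->; rewrite oppr0. Qed.

Fact finsupp_add_subproof (f g : T) :
  exists s : seq X, forall x, x \notin s -> fcoef f x + fcoef g x = 0.
Proof.
case: f g => [f [s fs]] [g [t gt]]; exists (s ++ t) => x.
by rewrite mem_cat negb_or => /andP[/fs /= -> /gt ->]; rewrite addr0.
Qed.

Let zero : T := exist _ (fun=> 0) finsupp_zero_subproof.
Let opp (f : T) : T := exist _ (fun x => - fcoef f x) (finsupp_opp_subproof f).
Let add (f g : T) : T :=
  exist _ (fun x => fcoef f x + fcoef g x) (finsupp_add_subproof f g).

Fact finsupp_addA : associative add.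
Proof. by move=> f g h; apply: finsupp_ext => x; apply: addrA. Qed.
Fact finsupp_addC : commutative add.
Proof. by move=> f g; apply: finsupp_ext => x; apply: addrC. Qed.
Fact finsupp_add0 : left_id zero add.
Proof. by move=> f; apply: finsupp_ext => x; apply: add0r. Qed.
Fact finsupp_addN : left_inverse zero opp add.
Proof. by move=> f; apply: finsupp_ext => x; apply: addNr. Qed.

HB.instance Definition _ := GRing.isZmodule.Build T finsupp_addA finsupp_addC
  finsupp_add0 finsupp_addN.

Arguments fcoef : simpl never.

Lemma fcoefD (f g : T) x : fcoef (f + g) x = fcoef f x + fcoef g x.
Proof. by []. Qed.
Lemma fcoefB (f g : T) x : fcoef (f - g) x = fcoef f x - fcoef g x.
Proof. by []. Qed.

Lemma fcoef_sum (I : Type) (r : seq I) (F : I -> T) x :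
  fcoef (\sum_(i <- r) F i) x = \sum_(i <- r) fcoef (F i) x.
Proof. by elim/big_rec2: _ => // i a f _ <-. Qed.

Fact single_subproof (x : X) (k : K) : exists s : seq X, forall y,
  y \notin s -> (fun y => if y == x then k else 0) y = 0.
Proof. by exists [:: x] => y; rewrite inE => /negbTE ->. Qed.

Definition single x k : T := exist _ _ (single_subproof x k).

Lemma fcoef_single x k y : fcoef (single x k) y = if y == x then k else 0.
Proof. by []. Qed.

Lemma singleD x : {morph single x : k l / k + l}.
Proof.
move=> k l; apply: finsupp_ext => y; rewrite fcoefD !fcoef_single.
by case: eqP; rewrite ?addr0.
Qed.

Definition supp (f : T) : seq X := undup (sval (cid (proj2_sig f))).

Lemma supp_uniq f : uniq (supp f). Proof. exact: undup_uniq. Qed.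

Lemma fcoef_supp f x : x \notin supp f -> fcoef f x = 0.
Proof. by rewrite /supp mem_undup; case: cid => s /= fs /fs. Qed.

Lemma finsupp_sum (f : T) : f = \sum_(x <- supp f) single x (fcoef f x).
Proof.
apply: finsupp_ext => y; rewrite fcoef_sum.
have [yf|yf] := boolP (y \in supp f).
  rewrite (bigD1_seq y) ?supp_uniq //= fcoef_single eqxx big1 ?addr0 // => x.
  by rewrite fcoef_single eq_sym => /negbTE ->.
rewrite fcoef_supp // big1_seq // => x /= xf; rewrite fcoef_single.
by case: eqP => // yx; rewrite yx xf in yf.
Qed.

Lemma finsupp_ind (P : T -> Prop) :
  P 0 -> (forall f g, P f -> P g -> P (f + g)) -> (forall x k, P (single x k)) ->
  forall f, P f.
Proof.
by move=> P0 PD P1 f; rewrite [f]finsupp_sum; elim/big_ind: _ => // x _.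
Qed.

End FinsuppZmodule.
Arguments fcoef : simpl never.

Section FinsuppLmodule.
Variables (R : pzRingType) (X : choiceType) (K : lmodType R).
Local Notation T := (finsupp X K).

Fact finsupp_scale_subproof (a : R) (f : T) :
  exists s : seq X, forall x, x \notin s -> a *: fcoef f x = 0.
Proof.
case: f => f [s fs]; exists s => x /fs; rewrite /fcoef /= => ->.
exact: scaler0.
Qed.

Let scale (a : R) (f : T) : T :=
  exist _ (fun x => a *: fcoef f x) (finsupp_scale_subproof a f).

Fact finsupp_scaleA a b f : scale a (scale b f) = scale (a * b) f.
Proof. by apply: finsupp_ext => x; apply: scalerA. Qed.
Fact finsupp_scale1 : left_id 1 scale.
Proof. by move=> f; apply: finsupp_ext => x; apply: scale1r. Qed.
Fact finsupp_scaleDr : right_distributive scale +%R.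
Proof. by move=> a f g; apply: finsupp_ext => x; apply: scalerDr. Qed.
Fact finsupp_scaleDl f : {morph scale^~ f : a b / a + b}.
Proof. by move=> a b; apply: finsupp_ext => x; apply: scalerDl. Qed.

HB.instance Definition _ := GRing.Zmodule_isLmodule.Build R T
  finsupp_scaleA finsupp_scale1 finsupp_scaleDr finsupp_scaleDl.

Lemma fcoefZ (a : R) (f : T) x : fcoef (a *: f) x = a *: fcoef f x.
Proof. by []. Qed.

Lemma scale_single (a : R) x (k : K) : a *: single x k = single x (a *: k) :> T.
Proof.
apply: finsupp_ext => y; rewrite fcoefZ !fcoef_single.
by case: eqP => // _; rewrite scaler0.
Qed.

End FinsuppLmodule.

Lemma morph0 (K L : zmodType) (u : K -> L) : {morph u : k l / k + l} -> u 0 = 0.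
Proof. by move=> uD; apply: (addIr (u 0)); rewrite -uD !add0r. Qed.

Section Fold.
Variables (X : choiceType) (K L : zmodType) (h : X -> K -> L).
Hypothesis hD : forall x, {morph h x : k l / k + l}.

Definition fold (f : finsupp X K) : L := \sum_(x <- supp f) h x (fcoef f x).

Lemma foldE f (s : seq X) :
  uniq s -> (forall x, x \notin s -> fcoef f x = 0) ->
  fold f = \sum_(x <- s) h x (fcoef f x).
Proof.
move=> us fs; rewrite /fold.
have filt (r : seq X) : \sum_(x <- r) h x (fcoef f x) =
    \sum_(x <- [seq x <- r | fcoef f x != 0]) h x (fcoef f x).
  rewrite big_filter [LHS](bigID (fun x => fcoef f x != 0)) /=.
  rewrite [X in _ + X]big1 ?addr0 // => x /negPn/eqP ->.
  exact: morph0.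
rewrite filt [RHS]filt; apply: perm_big; apply: uniq_perm.
- by rewrite filter_uniq ?supp_uniq.
- by rewrite filter_uniq.
move=> x; rewrite !mem_filter; case: eqP => //= /eqP fx0.
have [xs|/fs/eqP] := boolP (x \in s); last by rewrite (negbTE fx0).
by apply: contraNT fx0 => /fcoef_supp ->.
Qed.

Lemma foldD : {morph fold : f g / f + g}.
Proof.
move=> f g; set s := undup (supp f ++ supp g).
have us : uniq s by apply: undup_uniq.
have fs x : x \notin s -> fcoef f x = 0 /\ fcoef g x = 0.
  rewrite mem_undup mem_cat negb_or => /andP[xf xg].
  by rewrite !fcoef_supp.
rewrite !(foldE us) => [|x /fs[_ ->]//|x /fs[->]//|x /fs[]]; last first.
  by rewrite fcoefD => -> ->; rewrite addr0.
by rewrite -big_split; apply: eq_bigr => x _; apply: hD.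
Qed.

Lemma fold_single x k : fold (single x k) = h x k.
Proof.
rewrite (foldE (s := [:: x])) // => [|y]; last first.
  by rewrite inE fcoef_single => /negbTE ->.
by rewrite big_seq1 fcoef_single eqxx.
Qed.

End Fold.

Lemma finsupp_morph_ext (X : choiceType) (K L : zmodType)
    (u v : finsupp X K -> L) :
  {morph u : f g / f + g} -> {morph v : f g / f + g} ->
  (forall x k, u (single x k) = v (single x k)) -> u =1 v.
Proof.
move=> uD vD uv; apply: finsupp_ind => // [|f g uf ug].
  by rewrite !morph0.
by rewrite uD vD uf ug.
Qed.

Section Fmap.
Variables (X : choiceType) (K L : zmodType) (u : K -> L).
Hypothesis uD : {morph u : k l / k + l}.

Definition fmap : finsupp X K -> finsupp X L := fold (fun x k => single x (u k)).

Let hD (x : X) : {morph (fun k => single x (u k)) : k l / k + l}.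
Proof. by move=> k l; rewrite uD singleD. Qed.

Lemma fmapD : {morph fmap : f g / f + g}. Proof. exact: foldD. Qed.

Lemma fmap_single x k : fmap (single x k) = single x (u k).
Proof. exact: fold_single. Qed.

Lemma fcoef_fmap f x : fcoef (fmap f) x = u (fcoef f x).
Proof.
have u0 := morph0 uD.
apply: (finsupp_morph_ext (u := fun f => fcoef (fmap f) x)
  (v := fun f => u (fcoef f x))) => [f' g|f' g|y k].
- by rewrite fmapD.
- by rewrite fcoefD uD.
- by rewrite fmap_single !fcoef_single; case: eqP.
Qed.

End Fmap.

Section FreeModule.
Variables (R : pzRingType) (X : choiceType).
Local Notation F := (finsupp X R^o).

Lemma free_lift (V : lmodType R) (v : X -> V) :
  exists g : {linear F -> V}, forall x (a : R), g (single x (a : R^o)) = a *: v x.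
Proof.
pose h x (a : R^o) : V := (a : R) *: v x.
have hD x : {morph h x : a b / a + b} by move=> a b; apply: scalerDl.
have [a f g|g gE] := @ex_linear R F V (fold h).
  rewrite foldD //; congr (_ + _); elim/finsupp_ind: f => [|f1 f2 e1 e2|x k].
  - by rewrite scaler0 morph0 ?scaler0 //; apply: foldD.
  - by rewrite scalerDr !foldD // scalerDr e1 e2.
  - by rewrite scale_single !fold_single // /h scalerA.
by exists g => x a; rewrite gE fold_single.
Qed.

Lemma free_ext (V : lmodType R) (g h : {linear F -> V}) :
  (forall x, g (single x 1) = h (single x 1)) -> g =1 h.
Proof.
move=> gh; apply: finsupp_morph_ext => [f f'|f f'|x a]; rewrite ?linearD //.
have -> : single x a = (a : R) *: single x (1 : R^o) :> F.
  by rewrite scale_single [_ *: _]mulr1.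
by rewrite !linearZ gh.
Qed.

Lemma free_projective : projective_module F.
Proof.
move=> M N g f gsurj.
have /choice[m mE] x : exists m, g m = f (single x 1).
  have : range g (f (single x 1)) by rewrite gsurj.
  by case=> m _ <-; exists m.
have [h hE] := free_lift m; exists h.
apply: (@free_ext N (g \o h : {linear F -> N})) => x /=.
by rewrite hE scale1r mE.
Qed.

End FreeModule.

(** A finitely generated module gets a cover with a finite basis, which keeps
    the base changes of its syzygies finitely generated. *)
Lemma ex_free_cover (R : pzRingType) (V : lmodType R) :
  exists (X : choiceType) (p : {linear finsupp X R^o -> V}),
    (forall v, exists x, p x = v) /\
    (finitely_generated V -> exists n (f : 'I_n -> X), forall x, exists i, f i = x).
Proof.
have [[n [g gE]]|nfg] := pselect (finitely_generated V).
  have [p pE] := @free_lift R 'I_n V g; exists 'I_n, p; split=> [v|_].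
    have [c ->] := gE v; exists (\sum_i single i (c i : R^o)).
    by rewrite linear_sum; apply: eq_bigr => i _; rewrite pE.
  by exists n, id => i; exists i.
have [p pE] := @free_lift R V V id; exists V, p; split=> [v|/nfg//].
by exists (single v (1 : R^o)); rewrite pE scale1r.
Qed.

Lemma finitely_generated_free (R : pzRingType) (X : choiceType) (n : nat)
    (f : 'I_n -> X) :
  (forall x, exists i, f i = x) -> finitely_generated (finsupp X R^o).
Proof.
move=> fsurj; apply/finitely_generatedP.
exists [seq single (f i) (1 : R^o) | i <- enum 'I_n] => g.
set s := [seq _ | i <- _]; have hs := span_submodule s.
elim/finsupp_ind: g => [|g h|x a]; [exact: submod0|exact: submodD|].
have -> : single x a = (a : R) *: single x (1 : R^o) :> finsupp X R^o.
  by rewrite scale_single [_ *: _]mulr1.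
apply: submodZ => //; have [i <-] := fsurj x.
apply/span_sum; exists (fun j => (j == i)%:R); rewrite (bigD1 i) //=.
by rewrite eqxx scale1r big1 ?addr0 // => j /negbTE ->; rewrite scale0r.
Qed.

Lemma finitely_generated_image (R : pzRingType) (U V : lmodType R)
    (p : {linear U -> V}) :
  (forall v, exists u, p u = v) -> finitely_generated U -> finitely_generated V.
Proof.
move=> psurj [n [g gE]]; exists n, (p \o g) => v.
have [u <-] := psurj v; have [c ->] := gE u; exists c.
by rewrite linear_sum; apply: eq_bigr => i _; rewrite linearZ.
Qed.

(** * Projective dimension by dimension shifting *)

Section ProjectiveDimension.
Variable R : pzRingType.
Implicit Types K L M N P Q F G : lmodType R.

Definition short_exact K F M (i : {linear K -> F}) (p : {linear F -> M}) :=
  [/\ injective i, forall m, exists x, p x = m &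
      forall x, p x = 0 <-> exists k, i k = x].

Fixpoint pd_le (n : nat) M : Prop :=
  if n is n'.+1 then
    exists K F (i : {linear K -> F}) (p : {linear F -> M}),
      [/\ projective_module F, short_exact i p & pd_le n' K]
  else projective_module M.

Lemma projective_lift P M N (g : {linear M -> N}) (f : {linear P -> N}) :
  projective_module P -> (forall y, exists x, g x = y) ->
  exists h : {linear P -> M}, forall x, g (h x) = f x.
Proof.
move=> Pproj gsurj; have [|h hE] := Pproj M N g f; last by exists h => x; apply: hE.
by apply/seteqP; split=> // y _; have [x <-] := gsurj y; exists x.
Qed.

(** [M] is a direct summand of [N] up to projectives: the identity of [M]
    factors through [N] up to a map that factors through a projective. *)
Definition stable_summand M N : Prop :=
  exists Q (i : {linear M -> N}) (r : {linear N -> M})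
    (a : {linear M -> Q}) (b : {linear Q -> M}),
    projective_module Q /\ forall x, r (i x) + b (a x) = x.

Lemma projective_stable_summand M N :
  stable_summand M N -> projective_module N -> projective_module M.
Proof.
move=> [Q [i [r [a [b [Qproj ribaE]]]]]] Nproj U V g f gsurj.
have [h hE] := Nproj U V g (f \o r : {linear N -> V}) gsurj.
have [k kE] := Qproj U V g (f \o b : {linear Q -> V}) gsurj.
exists ((h \o i) \+ (k \o a) : {linear M -> U}) => x /=.
have := hE (i x); have := kE (a x); rewrite /= linearD => -> ->.
by rewrite -linearD ribaE.
Qed.

(** Schanuel's lemma for stable summands: lift [s], [r] and [b] to [f], [g] and
    [c] between the projective covers; the identity of [F] differs from
    [g f + c a p] by a map into [K], and [c a p] vanishes on [K], so that the
    identity of [K] factors through [L] up to a map through [F]. *)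
Lemma stable_summand_syzygy M N K F L G
    (i : {linear K -> F}) (p : {linear F -> M})
    (j : {linear L -> G}) (q : {linear G -> N}) :
  projective_module F -> projective_module G ->
  short_exact i p -> short_exact j q ->
  stable_summand M N -> stable_summand K L.
Proof.
move=> Fproj Gproj [ii psurj pE] [ji qsurj qE] [Q [s [r [a [b [Qproj rsba]]]]]].
have [f fE] := projective_lift (s \o p : {linear F -> N}) Fproj qsurj.
have [g gE] := projective_lift (r \o q : {linear G -> M}) Gproj psurj.
have [c cE] := projective_lift b Qproj psurj.
have [x|f' f'E] := factor_inj (g := f \o i : {linear K -> G}) ji.
  by apply/qE; rewrite fE /= (_ : p (i x) = 0) ?linear0 //; apply/pE; exists x.
have [x|g' g'E] := factor_inj (g := g \o j : {linear L -> F}) ii.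
  by apply/pE; rewrite gE /= (_ : q (j x) = 0) ?linear0 //; apply/qE; exists x.
have [|e eE] := @ex_linear R F F (fun x => x - g (f x) - c (a (p x))).
  move=> k x y /=; rewrite !linearP /= [X in X + _]addrACA [LHS]addrACA.
  by rewrite !scalerDr.
have [x|d dE] := factor_inj (g := e) ii.
  apply/pE; rewrite eE !linearB gE cE /= fE /=.
  by rewrite -[X in X - _ - _](rsba (p x)) addrAC addrK subrr.
exists F, f', g', i, d; split=> // x.
apply: ii; rewrite linearD g'E /= f'E /= dE eE /=.
have -> : p (i x) = 0 by apply/pE; exists x.
by rewrite !linear0 ?subr0 ?addr0 subrKC.
Qed.

Lemma ex_short_exact M : exists K F (i : {linear K -> F}) (p : {linear F -> M}),
  projective_module F /\ short_exact i p.
Proof.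
have [X [p [psurj _]]] := ex_free_cover M.
have [K [i [ii iE]]] := ex_submodule (submodule_ker p).
by exists K, (finsupp X R^o), i, p; split; [apply: free_projective|split].
Qed.

Lemma zero_linear M N : exists z : {linear M -> N}, forall x, z x = 0.
Proof. by apply: ex_linear => a u v; rewrite scaler0 addr0. Qed.

Lemma projective_zero M : (forall x : M, x = 0) -> projective_module M.
Proof.
move=> M0 U V g f _; have [z zE] := zero_linear M U.
by exists z => x; rewrite /= zE (M0 x) !linear0.
Qed.

Lemma retract_stable_summand M N (i : {linear M -> N}) (r : {linear N -> M}) :
  (forall x, r (i x) = x) -> stable_summand M N.
Proof.
move=> riE; have [K [F [_ [_ [Fproj _]]]]] := ex_short_exact M.
have [a aE] := zero_linear M F; have [b bE] := zero_linear F M.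
by exists F, i, r, a, b; split=> // x; rewrite riE bE addr0.
Qed.

Lemma projective_retract M N (i : {linear M -> N}) (r : {linear N -> M}) :
  (forall x, r (i x) = x) -> projective_module N -> projective_module M.
Proof. by move/retract_stable_summand; apply: projective_stable_summand. Qed.

Lemma ex_zero_module : exists Z : lmodType R, forall x : Z, x = 0.
Proof.
have [|Z [z [zi zE]]] := @ex_submodule R R^o [set 0].
  by split=> [//|a u v -> ->]; rewrite /= scaler0 addr0.
exists Z => x; apply: zi; rewrite linear0.
by have : [set 0] (z x) by apply/zE; exists x.
Qed.

Lemma pd_le_stable_summand n M N : pd_le n M -> stable_summand N M -> pd_le n N.
Proof.
elim: n M N => [|n IH] M N /=.
  by move=> Mproj /projective_stable_summand; apply.
move=> [K [F [i [p [Fproj ip nK]]]]] NM.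
have [L [G [j [q [Gproj jq]]]]] := ex_short_exact N.
exists L, G, j, q; split=> //; apply: IH nK _.
exact: (stable_summand_syzygy Gproj Fproj jq ip).
Qed.

(** Every syzygy computes the projective dimension, not only the one that
    the definition selects. *)
Lemma pd_le_syzygy n K F M (i : {linear K -> F}) (p : {linear F -> M}) :
  projective_module F -> short_exact i p -> pd_le n.+1 M <-> pd_le n K.
Proof.
move=> Fproj ip; split=> [|nK]; last by exists K, F, i, p.
move=> [L [G [j [q [Gproj jq nL]]]]]; apply: pd_le_stable_summand nL _.
apply: (stable_summand_syzygy Fproj Gproj ip jq).
exact: (retract_stable_summand (i := idfun) (r := idfun)).
Qed.

Lemma pd_le_succ n M : pd_le n M -> pd_le n.+1 M.
Proof.
elim: n M => [|n IH] M; last first.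
  move=> [K [F [i [p [Fproj ip nK]]]]]; exists K, F, i, p; split=> //.
  exact: IH.
move=> Mproj; have [K [F [i [p [Fproj ip]]]]] := ex_short_exact M.
have [Z Z0] := ex_zero_module; have [z zE] := zero_linear Z M.
exists Z, M, z, idfun; split=> //; last exact: projective_zero.
split=> [u v _|m|x]; [by rewrite (Z0 u) (Z0 v)|by exists m|].
by split=> [/= ->|[u <-]]; [exists 0; rewrite zE|rewrite zE].
Qed.

Lemma pd_le_mono n m M : (n <= m)%N -> pd_le n M -> pd_le m M.
Proof.
by move=> /subnK <-; elim: (m - n)%N => // k IH /IH; apply: pd_le_succ.
Qed.

Lemma pd_le_resolution n M : has_projective_resolution M n <-> pd_le n M.
Proof.
split.
  elim: n M => [|n IH] M [P [d [eps [Pproj P0 epsS d0 dS]]]].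
    have epsi : injective eps.
      move=> x y xy; apply/eqP; rewrite -subr_eq0; apply/eqP.
      have : range (d 0%N) (x - y) by rewrite d0 /= linearB xy subrr.
      move=> [z _ <-]; have : [set: P 1%N] z by [].
      by rewrite P0 // => ->; rewrite linear0.
    have epss m : exists x, eps x = m.
      by have : range eps m by [rewrite epsS]; case=> x _ <-; exists x.
    have [|s sE] := factor_inj (g := idfun : {linear M -> M}) epsi; first by [].
    exact: (projective_retract sE).
  have [K [i [ii iE]]] := ex_submodule (submodule_ker eps).
  exists K, (P 0%N), i, eps; split=> //.
    by split=> // m; have : range eps m by [rewrite epsS]; case=> x _ <-; exists x.
  apply: IH; have [x|e eE] := factor_inj (g := d 0%N) ii.
    by apply/iE; have : range (d 0%N) (d 0%N x) by [exists x]; rewrite d0.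
  exists (fun i => P i.+1), (fun i => d i.+1), e; split=> //.
  - by move=> j nj; apply: P0.
  - apply/seteqP; split=> // k _.
    have : range (d 0%N) (i k) by rewrite d0; apply/iE; exists k.
    by move=> [x _ xk]; exists x => //; apply: ii; rewrite eE.
  - rewrite dS; apply/seteqP; split=> x /=.
      by move=> dx; apply: ii; rewrite eE dx linear0.
    by rewrite -eE => ->; rewrite linear0.
elim: n M => [|n IH] M /=.
  move=> Mproj; have [Z Z0] := ex_zero_module.
  pose P (i : nat) : lmodType R := if i is 0%N then M else Z.
  have z i : {z : {linear P i.+1 -> P i} | forall x, z x = 0}.
    by apply: cid; apply: zero_linear.
  exists P, (fun i => sval (z i)), idfun; split=> [[|i]|[|i] // _|||i] //=.
  - exact: projective_zero.
  - by apply/seteqP; split=> // x _; apply: Z0.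
  - by apply/seteqP; split=> // x _; exists x.
  - apply/seteqP; split=> x /=; first by move=> [y _ <-]; apply: (svalP (z 0%N)).
    by move=> ->; exists 0; rewrite // linear0.
  - apply/seteqP; split=> x /= _; first exact: (svalP (z i)).
    by exists 0; rewrite // linear0 (Z0 x).
move=> [K [F [i [p [Fproj [ii psurj pE]] nK]]]].
have [P [d [eps [Pproj P0 epsS d0 dS]]]] := IH _ nK.
pose P' (j : nat) : lmodType R := if j is j'.+1 then P j' else F.
pose d' (j : nat) : {linear P' j.+1 -> P' j} :=
  if j is j'.+1 then d j' else i \o eps : {linear P 0%N -> F}.
exists P', d', p; split=> [[|j]|[|j] //|||[|j]] //=.
- exact: P0.
- by apply/seteqP; split=> // m _; have [x <-] := psurj m; exists x.
- apply/seteqP; split=> x /=.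
    by move=> [y _ <-]; apply/pE; exists (eps y).
  move=> /pE[k <-]; have : range eps k by rewrite epsS.
  by move=> [y _ <-]; exists y.
- rewrite d0; apply/seteqP; split=> x /=; first by move=> ->; rewrite linear0.
  by rewrite -[RHS](linear0 i) => /ii.
- exact: dS.
Qed.

End ProjectiveDimension.

(** * Tensoring maps of free modules *)

Section Tensor.
Variables (A : pzRingType) (K : zmodType) (act : K -> A -> K).

(** A right module is given here by its action alone, so that a ring [B] can
    be at once a right [A]-module along a homomorphism and a left module over
    itself. *)
Definition right_action : Prop :=
  [/\ forall a, {morph act^~ a : k l / k + l},
      forall k, {morph act k : a b / a + b},
      forall k a b, act k (a * b) = act (act k a) b &
      forall k, act k 1 = k].

Hypothesis actP : right_action.
Implicit Types X Y Z : choiceType.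

Definition tensor X Y (d : finsupp X A^o -> finsupp Y A^o) :
    finsupp X K -> finsupp Y K :=
  fold (fun x k => fmap (act k : A^o -> K) (d (single x (1 : A^o)))).

Let actDl a : {morph act^~ a : k l / k + l}. Proof. by case: actP. Qed.
Let actDr k : {morph (act k : A^o -> K) : a b / a + b}. Proof. by case: actP. Qed.
Let actM k a b : act k (a * b) = act (act k a) b. Proof. by case: actP. Qed.
Let act1 k : act k 1 = k. Proof. by case: actP. Qed.

Let termD X Y (d : finsupp X A^o -> finsupp Y A^o) (x : X) :
  {morph (fun k => fmap (act k : A^o -> K) (d (single x (1 : A^o)))) :
     k l / k + l}.
Proof.
move=> k l; apply: finsupp_ext => y; rewrite fcoefD !fcoef_fmap //.
exact: actDl.
Qed.

Lemma tensorD X Y (d : finsupp X A^o -> finsupp Y A^o) :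
  {morph tensor d : f g / f + g}.
Proof. by apply: foldD; apply: termD. Qed.

Lemma tensor0 X Y (d : finsupp X A^o -> finsupp Y A^o) : tensor d 0 = 0.
Proof. by apply: morph0; apply: tensorD. Qed.

Lemma tensorB X Y (d : finsupp X A^o -> finsupp Y A^o) :
  {morph tensor d : f g / f - g}.
Proof. by move=> f g; apply: (addIr (tensor d g)); rewrite -tensorD !subrK. Qed.

Lemma tensor_sum X Y (d : finsupp X A^o -> finsupp Y A^o) (I : Type)
    (r : seq I) (F : I -> finsupp X K) :
  tensor d (\sum_(i <- r) F i) = \sum_(i <- r) tensor d (F i).
Proof. by apply: big_morph; [apply: tensorD|apply: tensor0]. Qed.

Lemma tensor_single X Y (d : finsupp X A^o -> finsupp Y A^o) x k :
  tensor d (single x k) = fmap (act k : A^o -> K) (d (single x (1 : A^o))).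
Proof. by apply: fold_single; apply: termD. Qed.

Lemma tensor_pure X Y (d : {linear finsupp X A^o -> finsupp Y A^o}) k f :
  tensor d (fmap (act k : A^o -> K) f) = fmap (act k : A^o -> K) (d f).
Proof.
apply: (finsupp_morph_ext (u := fun f => tensor d (fmap (act k : A^o -> K) f))
  (v := fun f => fmap (act k : A^o -> K) (d f))) => [g h|g h|x a].
- by rewrite fmapD // tensorD.
- by rewrite linearD fmapD.
- rewrite fmap_single // tensor_single.
  have -> : single x a = (a : A) *: single x (1 : A^o) :> finsupp X A^o.
    by rewrite scale_single [_ *: _]mulr1.
  rewrite linearZ; apply: finsupp_ext => y; rewrite !fcoef_fmap //.
  by rewrite -actM.
Qed.

Lemma tensor_comp X Y Z (d : {linear finsupp Y A^o -> finsupp Z A^o})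
    (e : finsupp X A^o -> finsupp Y A^o) (c : finsupp X A^o -> finsupp Z A^o) f :
  (forall g, d (e g) = c g) -> tensor d (tensor e f) = tensor c f.
Proof.
move=> dec; apply: (finsupp_morph_ext (u := fun f => tensor d (tensor e f))
  (v := tensor c)) => [g h|g h|x k].
- by rewrite !tensorD.
- by rewrite tensorD.
- by rewrite !tensor_single tensor_pure dec.
Qed.

Lemma tensor_null X Y (d : finsupp X A^o -> finsupp Y A^o) f :
  (forall g, d g = 0) -> tensor d f = 0.
Proof.
move=> d0; apply: (finsupp_morph_ext (u := tensor d) (v := fun=> 0))
  => [g h|g h|x k]; rewrite ?addr0 ?tensorD // tensor_single d0.
by apply: morph0; apply: fmapD.
Qed.

Lemma tensor_add X Y (d e c : finsupp X A^o -> finsupp Y A^o) f :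
  (forall g, d g + e g = c g) -> tensor d f + tensor e f = tensor c f.
Proof.
move=> dec; apply: (finsupp_morph_ext (u := fun f => tensor d f + tensor e f)
  (v := tensor c)) => [g h|g h|x k].
- by rewrite !tensorD addrACA.
- by rewrite tensorD.
- by rewrite !tensor_single -dec fmapD.
Qed.

Lemma tensor_id X (d : finsupp X A^o -> finsupp X A^o) f :
  (forall g, d g = g) -> tensor d f = f.
Proof.
move=> dE; apply: (finsupp_morph_ext (u := tensor d) (v := id)) => [g h|g h|x k] //.
  by rewrite tensorD.
by rewrite tensor_single dE fmap_single // act1.
Qed.

Definition tensor_exact X Y Z (e : finsupp X A^o -> finsupp Y A^o)
    (d : finsupp Y A^o -> finsupp Z A^o) : Prop :=
  forall w, tensor d w = 0 -> exists v, tensor e v = w.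

End Tensor.

Lemma tensor_natural (A : pzRingType) (K L : zmodType)
    (act : K -> A -> K) (act' : L -> A -> L) (u : K -> L)
    (X Y : choiceType) (d : finsupp X A^o -> finsupp Y A^o) f :
  right_action act -> right_action act' -> {morph u : k l / k + l} ->
  (forall k a, u (act k a) = act' (u k) a) ->
  fmap u (tensor act d f) = tensor act' d (fmap u f).
Proof.
move=> actP actP' uD ua.
have [_ actDr _ _] := actP; have [_ actDr' _ _] := actP'.
apply: (finsupp_morph_ext (u := fun f => fmap u (tensor act d f))
  (v := fun f => tensor act' d (fmap u f))) => [g h|g h|x k].
- by rewrite tensorD // fmapD.
- by rewrite fmapD // tensorD.
- rewrite tensor_single // fmap_single // tensor_single //.
  by apply: finsupp_ext => y; rewrite !fcoef_fmap.
Qed.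

Lemma tensor_linear (A R : pzRingType) (K : lmodType R) (act : K -> A -> K)
    (X Y : choiceType) (d : finsupp X A^o -> finsupp Y A^o) :
  right_action act -> (forall r k a, act (r *: k) a = r *: act k a) ->
  linear (tensor act d).
Proof.
move=> actP actZ a f g; have [_ actDr _ _] := actP.
rewrite tensorD //; congr (_ + _).
apply: (finsupp_morph_ext (u := fun f => tensor act d (a *: f))
  (v := fun f => a *: tensor act d f)) => [h k|h k|x k].
- by rewrite scalerDr tensorD.
- by rewrite tensorD // scalerDr.
- rewrite scale_single !tensor_single //; apply: finsupp_ext => y.
  by rewrite fcoefZ !fcoef_fmap //.
Qed.

Section RightModules.
Variable A : pzRingType.

Definition module_action (K : lmodType A^c) (k : K) (a : A) : K := (a : A^c) *: k.

Lemma module_actionP (K : lmodType A^c) : right_action (@module_action K).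
Proof.
split=> [a k l|k a b|k a b|k]; rewrite /module_action.
- exact: scalerDr.
- exact: scalerDl.
- by rewrite scalerA.
- exact: scale1r.
Qed.

Lemma regular_actionP : right_action (fun k a : A => k * a).
Proof.
split=> [a k l|k a b|k a b|k].
- exact: mulrDl.
- exact: mulrDr.
- exact: mulrA.
- exact: mulr1.
Qed.

Lemma tensor_regular (X Y : choiceType)
    (d : {linear finsupp X A^o -> finsupp Y A^o}) (f : finsupp X A^o) :
  tensor (K := A^o) (fun k a : A => k * a) d f = d f.
Proof.
apply: (finsupp_morph_ext (u := tensor (K := A^o) (fun k a : A => k * a) d) (v := d))
  => [g h|g h|x a].
- by rewrite tensorD //; apply: regular_actionP.
- by rewrite linearD.
- rewrite tensor_single; last exact: regular_actionP.
  have -> : single x a = (a : A) *: single x (1 : A^o) :> finsupp X A^o.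
    by rewrite scale_single [_ *: _]mulr1.
  rewrite linearZ; apply: finsupp_ext => y; rewrite fcoef_fmap // => b c.
  exact: mulrDr.
Qed.

(** Projective right modules are flat. A cycle [w] with coefficients in [K] is
    written in a dual basis of [K]; each coordinate of [w] is a cycle over [A],
    hence a boundary, and the boundaries are reassembled. *)
Lemma projective_tensor_exact (K : lmodType A^c) (X Y Z : choiceType)
    (e : {linear finsupp X A^o -> finsupp Y A^o})
    (d : {linear finsupp Y A^o -> finsupp Z A^o}) :
  projective_module K -> (forall w, d w = 0 -> exists v, e v = w) ->
  tensor_exact (@module_action K) e d.
Proof.
move=> Kproj ed w dw; have actP := @module_actionP K.
have [_ actDr _ _] := actP.
have [p pE] := @free_lift A^c K K id.
have psurj k : exists f, p f = k.
  by exists (single k (1 : A^c^o)); rewrite pE scale1r.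
have [s sE] := projective_lift (idfun : {linear K -> K}) Kproj psurj.
pose lam (y : K) (k : K) : A^o := fcoef (s k) y.
have lamD y : {morph lam y : k l / k + l} by move=> k l; rewrite /lam linearD.
have lamA y k a : lam y (module_action k a) = lam y k * a by rewrite /lam linearZ.
have /choice[v vE] y : exists v, e v = fmap (lam y) w.
  apply: ed; rewrite -tensor_regular.
  rewrite -(tensor_natural (act := @module_action K)) //; last exact: regular_actionP.
  by rewrite dw; apply: morph0; apply: fmapD.
pose T := undup (flatten [seq supp (s (fcoef w x)) | x <- supp w]).
exists (\sum_(y <- T) fmap (fun a : A^o => module_action y a) (v y)).
rewrite tensor_sum //; apply: finsupp_ext => x; rewrite fcoef_sum.
transitivity (\sum_(y <- T) (fcoef (s (fcoef w x)) y : A^c) *: y).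
  apply: eq_bigr => y _; rewrite tensor_pure // vE !fcoef_fmap //.
have hD (y : K) : {morph (fun a : A^c^o => (a : A^c) *: y) : a b / a + b}.
  by move=> a b; apply: scalerDl.
rewrite -[RHS](sE (fcoef w x)).
have -> : p (s (fcoef w x)) =
    fold (fun y (a : A^c^o) => (a : A^c) *: y) (s (fcoef w x)).
  apply: (finsupp_morph_ext (u := p)) => [f g|f g|y a].
  - by rewrite linearD.
  - by rewrite foldD.
  - by rewrite pE fold_single.
rewrite (foldE hD (undup_uniq _ : uniq T)) // => y.
rewrite mem_undup => /flattenP yT; apply: contrapT => sy; apply: yT.
exists (supp (s (fcoef w x))); last first.
  by apply/negPn/negP => /fcoef_supp.
apply/mapP; exists x => //; apply/negPn/negP => /fcoef_supp wx.
by apply: sy; rewrite wx linear0.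
Qed.

(** Dimension shifting in the right module: a cycle with coefficients in [K]
    lifts to a chain with coefficients in [Q], whose boundary is a cycle with
    coefficients in the syzygy of [K], one degree lower. *)
Lemma pd_le_tensor_exact (X : nat -> choiceType)
    (d : forall i, {linear finsupp (X i.+1) A^o -> finsupp (X i) A^o})
    (K : lmodType A^c) n :
  (forall i w, d i w = 0 <-> exists v, d i.+1 v = w) -> pd_le n K ->
  forall i, (n <= i)%N -> tensor_exact (@module_action K) (d i.+1) (d i).
Proof.
move=> dex; elim: n K => [|n IH] K /=.
  by move=> Kproj i _; apply: projective_tensor_exact => // w /dex.
move=> [L [Q [j [p [Qproj [ji psurj pE] nL]]]]] [//|i] ni w dw.
have actK := @module_actionP K; have actQ := @module_actionP Q.
have actL := @module_actionP L.
have pD : {morph p : k l / k + l} by exact: linearD.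
have jD : {morph j : k l / k + l} by exact: linearD.
have pA k a : p (module_action k a) = module_action (p k) a by exact: linearZ.
have jA k a : j (module_action k a) = module_action (j k) a by exact: linearZ.
have [w' w'E] : exists w', fmap p w' = w.
  elim/finsupp_ind: w {dw} => [|f g [f' <-] [g' <-]|x k].
  - by exists 0; apply: morph0; apply: fmapD.
  - by exists (f' + g'); rewrite fmapD.
  - by have [q <-] := psurj k; exists (single x q); rewrite fmap_single.
have lift Z (z : finsupp Z Q) : fmap p z = 0 -> exists z', fmap j z' = z.
  move=> pz; have cz x : exists k, j k = fcoef z x.
    by apply/pE; have := congr1 (fun f => fcoef f x) pz; rewrite fcoef_fmap.
  have {}pz x := cz x; rewrite [z]finsupp_sum.
  elim/big_ind: _ => [|f g [f' <-] [g' <-]|x _].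
  - by exists 0; apply: morph0; apply: fmapD.
  - by exists (f' + g'); rewrite fmapD.
  - by have [k <-] := cz x; exists (single x k); rewrite fmap_single.
have [|u uE] := lift _ (tensor (@module_action Q) (d i.+1) w').
  by rewrite (tensor_natural (act' := @module_action K)) // w'E.
have [|v vE] := IH L nL i ni u.
  have inj : injective (fmap (X := X i) j).
    move=> f g fg; apply: finsupp_ext => x; apply: ji.
    by rewrite -!fcoef_fmap // fg.
  apply: inj; rewrite (tensor_natural (act' := @module_action Q)) // uE.
  rewrite (@tensor_comp _ _ _ actQ _ _ _ _ _ (fun=> 0)) // => [|f]; last first.
    by apply/dex; exists f.
  by rewrite tensor_null // morph0 //; apply: fmapD.
have [||z zE] := @projective_tensor_exact Q _ _ _ (d i.+2) (d i.+1) Qproj _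
  (w' - fmap j v).
- by move=> f /dex.
- by rewrite tensorB // -uE -(tensor_natural (act := @module_action L)) // vE subrr.
exists (fmap p z); rewrite -(tensor_natural (act := @module_action Q)) // zE.
apply: finsupp_ext => x; rewrite fcoef_fmap // fcoefB linearB -fcoef_fmap // w'E.
by rewrite fcoef_fmap // (_ : p (j _) = 0) ?subr0 //; apply/pE; exists (fcoef v x).
Qed.

End RightModules.

(** * The standard free resolution *)

Section FreeResolution.
Variable R : pzRingType.
Implicit Types V M : lmodType R.

Definition cover_basis V : choiceType := sval (cid (ex_free_cover V)).
Local Notation F V := (finsupp (cover_basis V) R^o).

Definition cover_map V : {linear F V -> V} :=
  sval (cid (svalP (cid (ex_free_cover V)))).

Lemma cover_map_surj V v : exists x, cover_map V x = v.
Proof. exact: (svalP (cid (svalP (cid (ex_free_cover V))))).1. Qed.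

Lemma cover_basis_finite V : finitely_generated V ->
  exists n (f : 'I_n -> cover_basis V), forall x, exists i, f i = x.
Proof. exact: (svalP (cid (svalP (cid (ex_free_cover V))))).2. Qed.

Let ex_syzygy V := ex_submodule (submodule_ker (cover_map V)).

Definition syzygy V : lmodType R := sval (cid (ex_syzygy V)).

Definition syzygy_incl V : {linear syzygy V -> F V} :=
  sval (cid (svalP (cid (ex_syzygy V)))).

Lemma syzygy_exact V : short_exact (syzygy_incl V) (cover_map V).
Proof.
have [ii iE] := svalP (cid (svalP (cid (ex_syzygy V)))).
by split; [|exact: cover_map_surj|].
Qed.

Fixpoint iter_syzygy M (n : nat) : lmodType R :=
  if n is n'.+1 then syzygy (iter_syzygy M n') else M.

Definition resolution_map M n :
    {linear F (iter_syzygy M n.+1) -> F (iter_syzygy M n)} :=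
  syzygy_incl (iter_syzygy M n) \o cover_map (iter_syzygy M n.+1).

Lemma resolution_map_range M n x :
  cover_map (iter_syzygy M n) x = 0 <-> exists y, resolution_map M n y = x.
Proof.
have [_ _ ->] := syzygy_exact (iter_syzygy M n).
split=> [[k <-]|[y <-]]; last by exists (cover_map (iter_syzygy M n.+1) y).
by have [y <-] := cover_map_surj k; exists y.
Qed.

Lemma resolution_map_ker M n x :
  resolution_map M n x = 0 <-> cover_map (iter_syzygy M n.+1) x = 0.
Proof.
have [ii _ _] := syzygy_exact (iter_syzygy M n).
by split=> [|/= ->]; [rewrite -[RHS](linear0 (syzygy_incl _)) => /ii|rewrite linear0].
Qed.

Lemma pd_le_iter_syzygy M i k :
  pd_le k (iter_syzygy M i) <-> projective_module (iter_syzygy M (i + k)).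
Proof.
elim: k i => [|k IH] i; first by rewrite addn0.
rewrite addnS -addSn -IH; apply: pd_le_syzygy (syzygy_exact _).
exact: free_projective.
Qed.

Lemma finitely_generated_syzygy M n :
  left_artinian R -> finitely_generated M -> finitely_generated (iter_syzygy M n).
Proof.
move=> artR Mfg; elim: n => [|n IH] //=; set V := iter_syzygy M n.
have [m [f fsurj]] := cover_basis_finite IH.
have [s sE] := finitely_generated_submodule artR (finitely_generated_free R fsurj)
  (submodule_ker (cover_map V)).
have [ii _ iE] := syzygy_exact V.
have [t ts] : exists t, s = map (syzygy_incl V) t.
  have : forall x, x \in s -> exists k, syzygy_incl V k = x.
    move=> x xs; apply/iE; suff : seq_span s x by rewrite -sE.
    elim: (s) xs => //= y r IHr; rewrite inE => /predU1P[->|/IHr rx].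
      exists y, 0; rewrite addr0; split=> //; first by exists 1; rewrite scale1r.
      exact: submod0 (span_submodule r).
    by exists 0, x; rewrite add0r; split=> //; exists 0; rewrite scale0r.
  elim: (s) => [|x r IHr] sK; first by exists [::].
  have [|t ->] := IHr; first by move=> y yr; apply: sK; rewrite inE yr orbT.
  by have [|k <-] := sK x; [rewrite inE eqxx|exists (k :: t)].
apply/finitely_generatedP; exists t => k.
have : seq_span s (syzygy_incl V k) by rewrite -sE; apply/iE; exists k.
rewrite ts; elim: (t) k => [|x r IHr] k /=.
  by rewrite -[X in _ = X](linear0 (syzygy_incl V)) => /ii.
move=> [_ [y [[a ->] ry kE]]]; exists (a *: x), (k - a *: x).
split; rewrite ?subrKC //; first by exists a.
by apply: IHr; rewrite linearB kE linearZ addrAC subrr add0r.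
Qed.

End FreeResolution.

(** * Base change along a radical-preserving homomorphism *)

Section BaseChange.
Variables (A B : pzRingType) (phi : {rmorphism A -> B}).
Implicit Types X Y Z : choiceType.
Local Notation JA := (jacobson_radical A).
Local Notation JB := (jacobson_radical B).

Definition restricted_action (b : B^o) (a : A) : B^o := (b : B) * phi a.

Lemma restricted_actionP : right_action restricted_action.
Proof.
split=> [a k l|k a b|k a b|k]; rewrite /restricted_action.
- exact: mulrDl.
- by rewrite rmorphD mulrDr.
- by rewrite rmorphM mulrA.
- by rewrite rmorph1 mulr1.
Qed.

Lemma base_change_linear X Y (d : {linear finsupp X A^o -> finsupp Y A^o}) :
  linear (tensor restricted_action d).
Proof.
apply: tensor_linear; first exact: restricted_actionP.
by move=> r b a; rewrite /restricted_action /= /GRing.scale /= mulrA.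
Qed.

Definition base_change X Y (d : {linear finsupp X A^o -> finsupp Y A^o}) :
    {linear finsupp X B^o -> finsupp Y B^o} :=
  sval (cid (ex_linear (base_change_linear d))).

Lemma base_changeE X Y (d : {linear finsupp X A^o -> finsupp Y A^o}) f :
  base_change d f = tensor restricted_action d f.
Proof. exact: (svalP (cid (ex_linear (base_change_linear d)))). Qed.

Lemma base_change_comp0 X Y Z (d : {linear finsupp Y A^o -> finsupp Z A^o})
    (e : {linear finsupp X A^o -> finsupp Y A^o}) f :
  (forall g, d (e g) = 0) -> base_change d (base_change e f) = 0.
Proof.
move=> de; rewrite !base_changeE; have actP := restricted_actionP.
by rewrite (@tensor_comp _ _ _ actP _ _ _ _ _ (fun=> 0)) // tensor_null.
Qed.

Definition extend X : finsupp X A^o -> finsupp X B^o := fmap (phi : A^o -> B^o).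

Lemma fcoef_extend X (f : finsupp X A^o) x :
  fcoef (extend f) x = phi (fcoef f x).
Proof. by apply: fcoef_fmap; apply: rmorphD. Qed.

Lemma base_change_extend X Y (d : {linear finsupp X A^o -> finsupp Y A^o}) f :
  base_change d (extend f) = extend (d f).
Proof.
have ext Z (g : finsupp Z A^o) :
    extend g = fmap (restricted_action 1 : A^o -> B^o) g.
  apply: finsupp_ext => z; rewrite fcoef_extend fcoef_fmap; last first.
    by have [_ + _ _] := restricted_actionP; apply.
  by rewrite /restricted_action mul1r.
by rewrite base_changeE !ext tensor_pure //; apply: restricted_actionP.
Qed.

Lemma base_change_exact (X : nat -> choiceType)
    (d : forall i, {linear finsupp (X i.+1) A^o -> finsupp (X i) A^o}) n i w :
  (forall i w, d i w = 0 <-> exists v, d i.+1 v = w) ->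
  pd_le n (right_restriction phi) -> (n <= i)%N ->
  base_change (d i) w = 0 -> exists v, base_change (d i.+1) v = w.
Proof.
move=> dex npd ni; rewrite base_changeE => dw.
have [v vE] := pd_le_tensor_exact dex npd ni dw.
by exists v; rewrite base_changeE.
Qed.

(** Composing [e] with a section gives an endomorphism [h] of the free module
    such that [h d = 0] and [1 - h = d t]. Both equations survive base change
    and make the cokernel [C] of the base change of [d] a direct summand of a
    free module. *)
Lemma projective_base_change X Y (d : {linear finsupp X A^o -> finsupp Y A^o})
    (M : lmodType A) (e : {linear finsupp Y A^o -> M})
    (C : lmodType B) (p : {linear finsupp Y B^o -> C}) :
  (forall m, exists x, e x = m) -> (forall x, e x = 0 <-> exists y, d y = x) ->
  (forall c, exists x, p x = c) ->
  (forall x, p x = 0 <-> exists y, base_change d y = x) ->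
  projective_module M -> projective_module C.
Proof.
move=> esurj ed psurj pd Mproj; have actP := restricted_actionP.
have [s sE] := projective_lift (idfun : {linear M -> M}) Mproj esurj.
pose h : {linear finsupp Y A^o -> finsupp Y A^o} := s \o e.
have [||t tE] := @projective_select _ _ (finsupp X A^o)
    [set q | q.1 - h q.1 = d q.2] (@free_projective A Y).
- split=> [|a [q k] [q' k'] /= qk qk']; first by rewrite /= !linear0 addr0.
  by rewrite !linearP /= -qk -qk' addrACA scalerDr.
- move=> q /=; have /ed[y <-] : e (q - h q) = 0; last by exists y.
  by rewrite linearB /h /= sE subrr.
have [x /pd[y <-]|k kE] := factor_surj (g := base_change h) psurj.
  apply: base_change_comp0 => g; rewrite /h /=.
  by rewrite (_ : e (d g) = 0) ?linear0 //; apply/ed; exists g.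
apply: (projective_retract (i := k) (r := p)) (@free_projective B Y) => c.
have [x <-] := psurj c; rewrite kE.
have {2}-> : x = base_change h x + base_change d (base_change t x).
  rewrite !base_changeE (@tensor_comp _ _ _ actP _ _ _ _ _ (d \o t)) //.
  rewrite (@tensor_add _ _ _ actP _ _ _ _ id) ?tensor_id // => g.
  by rewrite /= -tE addrC subrK.
by rewrite linearD [X in _ + X](_ : _ = 0) ?addr0 //; apply/pd; eexists.
Qed.

(** The radical of a free module is computed coordinatewise because [J(R)] is
    also a right ideal. *)
Lemma radical_fcoef (R : pzRingType) X (f : finsupp X R^o) :
  mulspan (jacobson_radical R) f <-> forall x, jacobson_radical R (fcoef f x).
Proof.
have hJ := @jacobson_submodule R; split=> [Jf x|Jf].
  elim: Jf => [|g h _ Jg _ Jh|a g Ja]; first exact: (left_ideal0 hJ).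
    by rewrite fcoefD; apply: (left_idealD hJ).
  by rewrite fcoefZ; apply: jacobson_mulr.
rewrite [f]finsupp_sum; apply: (submod_sum (radical_submodule _)) => x _.
have -> : single x (fcoef f x) = (fcoef f x : R) *: single x (1 : R^o) :> finsupp X R^o.
  by rewrite scale_single [_ *: _]mulr1.
exact: mulspanZ.
Qed.

Hypotheses (artA : left_artinian A) (artB : left_artinian B).
Hypotheses (phiJ : radical_preserving phi) (kerphi : superfluous_kernel phi).

(** The preimage of the nilpotent ideal [J(B)] is nil modulo the kernel, which
    lies in [J(A)]; a left ideal that is nil modulo [J(A)] is contained in
    every maximal left ideal. *)
Lemma radical_reflecting a : JB (phi a) -> JA a.
Proof.
move=> Ja; apply/jacobsonP => m [hm m1 mmax]; apply: contrapT => ma.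
have hL := submodule_sum_set hm (@submodule_cyclic A A^o a).
have [y [_ [my [c ->] yE]]] : sum_set m [set y | exists b : A, y = b *: (a : A^o)] 1.
  apply: contrapT => n1; apply: ma; apply: (mmax _ hL) => // [x mx|].
    by exists x, 0; rewrite addr0; split=> //; exists 0; rewrite scale0r.
  by exists 0, a; rewrite add0r; split=> //; [exact: hm.1|exists 1; rewrite scale1r].
pose b : A := c * a; have mb : m (1 - b).
  by rewrite yE [_ *: _](_ : _ = b) // addrK.
have [k k0] := jacobson_nilpotent artB.
have bk : radical_power k (phi (b ^+ k)).
  elim: (k) => [//|l IH]; exists (phi (b ^+ l)), (phi b).
  rewrite exprSr rmorphM; split=> //.
  by rewrite /b rmorphM; apply: jacobson_mull.
have mbk : m (b ^+ k).
  by have /jacobsonP := kerphi (k0 _ bk); apply.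
have mpow l : m (1 - b ^+ l).
  elim: l => [|l IH]; first by rewrite expr0 subrr; exact: hm.1.
  have -> : 1 - b ^+ l.+1 = b ^+ l * (1 - b) + (1 - b ^+ l).
    by rewrite mulrBr mulr1 exprSr [RHS]addrC addrA subrK.
  by apply: left_idealD => //; apply: left_idealM.
by apply: m1; rewrite -(subrK (b ^+ k) 1); apply: (left_idealD hm).
Qed.

Lemma radical_extend X (f : finsupp X A^o) : mulspan JA f -> mulspan JB (extend f).
Proof.
move=> /radical_fcoef Jf; apply/radical_fcoef => x; rewrite fcoef_extend.
by apply: phiJ; exists (fcoef f x).
Qed.

Lemma radical_extend_reflect X (f : finsupp X A^o) :
  mulspan JB (extend f) -> mulspan JA f.
Proof.
move=> /radical_fcoef Jf; apply/radical_fcoef => x; apply: radical_reflecting.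
by rewrite -fcoef_extend.
Qed.

Lemma radical_base_change X Y (c : finsupp X A^o -> finsupp Y A^o) z :
  (forall r, mulspan JA (c r)) -> mulspan JB (tensor restricted_action c z).
Proof.
move=> Jc; have actP := restricted_actionP.
have hJ := radical_submodule (finsupp Y B^o).
elim/finsupp_ind: z => [|f g Jf Jg|x b].
- by rewrite tensor0 //; apply: submod0.
- by rewrite tensorD //; apply: submodD.
- rewrite tensor_single //; apply/radical_fcoef => y; rewrite fcoef_fmap; last first.
    by have [_ + _ _] := actP; apply.
  apply: jacobson_mull; apply: phiJ; exists (fcoef (c (single x 1)) y) => //.
  exact: (radical_fcoef _).1.
Qed.

(** Let [K] be the image of [d1]. Suppose that [d1 y] is in the radical of the
    free module. Over [B] the image of [d1] is a direct summand, so the radical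
    element [d1 y] has a preimage in the radical, and by exactness [y] agrees
    over [B] with this preimage up to a boundary. Projecting [y] to a complement
    of the boundaries modulo the radical does not change [d1 y] and makes the
    boundary negligible, so the projection of [y] is in the radical over [B],
    hence over [A], and [d1 y] is in the radical of [K]. The splitting criterion
    then applies to [K]. *)
Lemma projective_base_change_reflect X0 X1 X2
    (d1 : {linear finsupp X1 A^o -> finsupp X0 A^o})
    (d2 : {linear finsupp X2 A^o -> finsupp X1 A^o})
    (M : lmodType A) (e : {linear finsupp X0 A^o -> M})
    (C : lmodType B) (p : {linear finsupp X0 B^o -> C}) :
  (forall m, exists x, e x = m) -> (forall x, e x = 0 <-> exists y, d1 y = x) ->
  (forall x, d1 x = 0 <-> exists y, d2 y = x) ->
  (forall x, base_change d1 x = 0 -> exists y, base_change d2 y = x) ->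
  (forall c, exists x, p x = c) ->
  (forall x, p x = 0 <-> exists y, base_change d1 y = x) ->
  projective_module C -> projective_module M.
Proof.
move=> esurj ed1 d12 bd12 psurj pd1 Cproj; have actP := restricted_actionP.
have [K [i [ii iE]]] := ex_submodule (submodule_ker e).
have [x|f fE] := factor_inj (g := d1) ii; first by apply/iE/ed1; exists x.
have [s sE] := projective_lift (idfun : {linear C -> C}) Cproj psurj.
(* 1 - s p maps the free module onto the image of d1 over B and fixes it. *)
have [||t tE] := @projective_select _ _ (finsupp X1 B^o)
    [set q | q.1 - s (p q.1) = base_change d1 q.2] (@free_projective B X0).
- split=> [|a [q k] [q' k'] /= qk qk']; first by rewrite /= !linear0 addr0.
  by rewrite !linearP /= -qk -qk' addrACA scalerDr.
- move=> q /=; have /pd1[y <-] : p (q - s (p q)) = 0; last by exists y.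
  by rewrite linearB sE subrr.
have hN := submodule_range d2.
have [S [hS SN SJ]] := radical_complement artA hN.
(* g is a linear projection to S along the boundaries, modulo the radical. *)
have [||g gE] := @projective_select _ _ (finsupp X1 A^o)
    [set q | S q.2 /\ exists y, d2 y = q.1 - q.2] (@free_projective A X1).
- split=> [|a [q k] [q' k'] /= [Sk [y yE]] [Sk' [y' y'E]]].
    by split; [apply: submod0|exists 0; rewrite /= linear0 subr0].
  split; first exact: hS.2.
  by exists (a *: y + y'); rewrite linearP yE y'E opprD addrACA scalerBr.
- move=> q; have [r [_ [Sr [y <-] ->]]] := SN q; exists r; split=> //=.
  by exists y; rewrite addrC addKr.
have gd2 z : mulspan JA (g (d2 z)).
  apply: SJ; have [Sg Ng] := gE (d2 z); split=> //.
  have -> : g (d2 z) = d2 z - (d2 z - g (d2 z)) by rewrite opprB addrCA subrr addr0.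
  by apply: (submodB hN) => //; exists z.
have iJ x : mulspan JA (i x) -> mulspan JA x.
  move=> Jix; have /ed1[y yE] : e (i x) = 0 by apply/iE; exists x.
  have d1g : d1 (g y) = d1 y.
    apply/esym/eqP; rewrite -subr_eq0 -linearB; apply/eqP/d12.
    exact: (gE y).2.
  have -> : x = f (g y) by apply: ii; rewrite fE d1g.
  apply: mulspan_linear; apply: radical_extend_reflect.
  set u := extend (d1 y); have Ju : mulspan JB u.
    by apply: radical_extend; rewrite yE.
  have pu : p u = 0 by apply/pd1; exists (extend y); rewrite base_change_extend.
  have [|z zE] := bd12 (extend y - t u).
    by rewrite linearB base_change_extend -tE /= pu linear0 subr0 subrr.
  rewrite -base_change_extend -(subrK (t u) (extend y)) linearD -zE.
  apply: mulspanD; last by do 2 apply: mulspan_linear.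
  rewrite !base_changeE (@tensor_comp _ _ _ actP _ _ _ _ _ (g \o d2)) //.
  exact: radical_base_change.
have [r rE] := radical_injective_split artA (@free_projective A X0) iJ.
have [|k kE] := @ex_linear A (finsupp X0 A^o) (finsupp X0 A^o)
  (fun q => q - i (r q)).
  by move=> a q q'; rewrite !linearP /= addrACA scalerDr.
have [x /iE[w <-]|h hE] := factor_surj (g := k) esurj.
  by rewrite kE rE subrr.
apply: (projective_retract (i := h) (r := e)) (@free_projective A X0) => m.
have [q <-] := esurj m; rewrite hE kE linearB (_ : e (i _) = 0) ?subr0 //.
by apply/iE; eexists.
Qed.

Section Cokernels.
Variable M : lmodType A.
Local Notation d := (resolution_map M).
Local Notation F i := (finsupp (cover_basis (iter_syzygy M i)) B^o).

Let ex_coker i := ex_quotient (submodule_range (base_change (d i))).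

(** The cokernel of the base change of [d i] is the base change of the [i]-th
    syzygy of [M]. *)
Definition base_change_syzygy i : lmodType B := sval (cid (ex_coker i)).

Definition base_change_cover i : {linear F i -> base_change_syzygy i} :=
  sval (cid (svalP (cid (ex_coker i)))).

Lemma base_change_cover_surj i c : exists x, base_change_cover i x = c.
Proof. exact: (svalP (cid (svalP (cid (ex_coker i))))).1. Qed.

Lemma base_change_cover_ker i x :
  base_change_cover i x = 0 <-> exists y, base_change (d i) y = x.
Proof. exact: (svalP (cid (svalP (cid (ex_coker i))))).2. Qed.

Lemma resolution_map_exact i w : d i w = 0 <-> exists v, d i.+1 v = w.
Proof. by rewrite resolution_map_ker resolution_map_range. Qed.

Variable n : nat.
Hypothesis npd : pd_le n (right_restriction phi).

Let bd_exact i w : (n <= i)%N ->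
  base_change (d i) w = 0 -> exists v, base_change (d i.+1) v = w.
Proof. by move=> ni; apply: (base_change_exact resolution_map_exact npd ni). Qed.

Lemma base_change_syzygy_exact i : (n <= i)%N ->
  exists j : {linear base_change_syzygy i.+1 -> F i},
    short_exact j (base_change_cover i).
Proof.
move=> ni.
have [x /base_change_cover_ker[y <-]|j jE] :=
  factor_surj (g := base_change (d i)) (@base_change_cover_surj i.+1).
  by apply: base_change_comp0 => g; apply/resolution_map_exact; exists g.
exists j; split=> [c c'|c|x]; last 2 first.
- exact: base_change_cover_surj.
- split=> [/base_change_cover_ker[y <-]|[c <-]].
    by exists (base_change_cover i.+1 y).
  have [y <-] := base_change_cover_surj c; rewrite jE.
  by apply/base_change_cover_ker; exists y.
have [x <-] := base_change_cover_surj c; have [x' <-] := base_change_cover_surj c'.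
rewrite !jE => /eqP; rewrite -subr_eq0 -linearB => /eqP/(bd_exact ni)[v vE].
apply/eqP; rewrite -subr_eq0 -linearB; apply/eqP/base_change_cover_ker.
by exists v.
Qed.

Lemma pd_le_base_change_syzygy i k : (n <= i)%N ->
  pd_le k (base_change_syzygy i) <-> projective_module (base_change_syzygy (i + k)).
Proof.
elim: k i => [|k IH] i ni; first by rewrite addn0.
have [j jE] := base_change_syzygy_exact ni.
rewrite addnS -addSn -IH; last exact: leqW.
by apply: pd_le_syzygy jE; apply: free_projective.
Qed.

Lemma projective_base_change_syzygy i : (n <= i)%N ->
  projective_module (base_change_syzygy i) <-> projective_module (iter_syzygy M i).
Proof.
move=> ni; split.
  apply: (projective_base_change_reflect (d1 := d i) (d2 := d i.+1)
    (e := cover_map (iter_syzygy M i)) (p := base_change_cover i)).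
  - exact: cover_map_surj.
  - exact: resolution_map_range.
  - exact: resolution_map_exact.
  - by move=> w; apply: bd_exact.
  - exact: base_change_cover_surj.
  - exact: base_change_cover_ker.
apply: (projective_base_change (d := d i)
  (e := cover_map (iter_syzygy M i)) (p := base_change_cover i)).
- exact: cover_map_surj.
- exact: resolution_map_range.
- exact: base_change_cover_surj.
- exact: base_change_cover_ker.
Qed.

Lemma pd_le_base_change k :
  pd_le (n + k) M <-> pd_le k (base_change_syzygy n).
Proof.
rewrite pd_le_base_change_syzygy // projective_base_change_syzygy ?leq_addr //.
exact: (pd_le_iter_syzygy M 0 (n + k)).
Qed.

Lemma finitely_generated_base_change_syzygy i :
  finitely_generated M -> finitely_generated (base_change_syzygy i).
Proof.
move=> Mfg; have [m [f fsurj]] :=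
  cover_basis_finite (finitely_generated_syzygy i artA Mfg).
apply: finitely_generated_image (finitely_generated_free B fsurj).
exact: base_change_cover_surj.
Qed.

End Cokernels.

End BaseChange.

(** * Homological dimensions as extended integers *)

Section ExtendedIntegers.
Import Order.TTheory.
Local Open Scope ereal_scope.

Definition extended_nat (e : \bar int) : Prop :=
  e = +oo \/ exists n : nat, e = n%:Z%:E.

Lemma extended_nat_ge0 e : extended_nat e -> 0 <= e.
Proof. by case=> [->|[n ->]] //; rewrite lee_fin. Qed.

Lemma supremums_extended_nat (E : set (\bar int)) :
  E `<=` extended_nat -> E !=set0 -> supremums E !=set0.
Proof.
move=> Enat [e0 Ee0].
have [[b bE]|nb] := pselect (exists b : nat, ubound E (b%:Z%:E)); last first.
  exists +oo; split=> [e _|u uE]; first exact: leey.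
  have u0 : 0 <= u by apply: le_trans (uE _ Ee0); apply/extended_nat_ge0/Enat.
  case: u u0 uE => [z|//|//]; rewrite lee_fin => z0 zE.
  by exfalso; apply: nb; exists `|z|%N; rewrite gez0_abs.
have exb : exists b : nat, `[< ubound E (b%:Z%:E) >] by exists b; apply/asboolP.
case: (ex_minnP exb) => {bE}b /asboolP bE bmin.
exists b%:Z%:E; split=> // u uE.
have u0 : 0 <= u by apply: le_trans (uE _ Ee0); apply/extended_nat_ge0/Enat.
case: u u0 uE => [z||//]; rewrite ?leey // lee_fin => z0 zE.
rewrite lee_fin -[z]gez0_abs // lez_nat; apply: bmin; apply/asboolP.
by rewrite gez0_abs.
Qed.

Lemma le_supremum_extended_nat (E : set (\bar int)) e :
  E `<=` extended_nat -> E e -> e <= supremum 0 E.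
Proof.
move=> Enat Ee; apply: ge_supremum_Nmem => //.
by apply: supremums_extended_nat => //; exists e.
Qed.

Lemma supremum_le_extended_nat (E : set (\bar int)) u :
  E `<=` extended_nat -> E !=set0 -> (forall e, E e -> e <= u) ->
  supremum 0 E <= u.
Proof.
move=> Enat E0 uE; rewrite /supremum ifF; last by apply/negbTE/set0P.
case: xgetP => [s sE [_ lub]|noSup]; first exact: lub.
by have [s /noSup] := supremums_extended_nat Enat E0.
Qed.

Section ProjectiveDimensionValue.
Variables (R : pzRingType) (M : lmodType R).

Lemma pdP : (pd M = +oo /\ forall n, ~ pd_le n M) \/
  exists n : nat, [/\ pd M = n%:Z%:E, pd_le n M & forall m, pd_le m M -> (n <= m)%N].
Proof.
have [[n nM]|nM] := pselect (exists n, pd_le n M); last first.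
  left; split=> [|n nM']; last by apply: nM; exists n.
  rewrite /pd /infimum ifT //; apply/eqP; rewrite -subset0 => x [n].
  move=> /pd_le_resolution nM' _.
  by apply: nM; exists n.
have exn : exists n, `[< pd_le n M >] by exists n; apply/asboolP.
case: (ex_minnP exn) => {nM}n /asboolP nM nmin; right; exists n.
have minn m : pd_le m M -> (n <= m)%N by move=> /asboolP; apply: nmin.
split=> //; pose E : set (\bar int) :=
  [set n%:Z%:E | n in has_projective_resolution M].
have nE : infimums E n%:Z%:E.
  split=> [_ [m /pd_le_resolution mM <-]|u]; first by rewrite lee_fin lez_nat minn.
  by apply; exists n => //; apply/pd_le_resolution.
have En : E n%:Z%:E by exists n => //; apply/pd_le_resolution.
rewrite /pd -/E /infimum ifF; last by apply/eqP => E0; rewrite E0 in En.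
by case: xgetP => [x _ xE|/(_ _ nE)//]; apply: is_subset1_infimums xE nE.
Qed.

Lemma pd_extended_nat : extended_nat (pd M).
Proof. by case: pdP => [[-> _]|[n [-> _ _]]]; [left|right; exists n]. Qed.

Lemma pd_le_pd n : pd_le n M -> pd M <= n%:Z%:E.
Proof.
case: pdP => [[_ nM] /nM//|[m [-> _ mmin]] /mmin nm].
by rewrite lee_fin lez_nat.
Qed.

End ProjectiveDimensionValue.

End ExtendedIntegers.

(** The three inequalities at once: [P] and [Q] select the modules over [A] and
    over [B] on which the suprema are taken. *)
Lemma supremum_pd_le (A B : pzRingType) (K : lmodType A^c)
    (P : lmodType A -> Prop) (Q : lmodType B -> Prop) :
  (exists M, P M) -> (exists N, Q N) ->
  (forall n, pd_le n K -> forall M, P M ->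
    exists2 N, Q N & forall k, pd_le k N -> pd_le (n + k) M) ->
  (supremum 0 [set e | exists M, P M /\ e = pd M] <=
   supremum 0 [set e | exists N, Q N /\ e = pd N] + pd K)%E.
Proof.
move=> [M0 PM0] [N0 QN0] PQ; set SA := [set _ | _]; set SB := [set _ | _].
have natA : SA `<=` extended_nat by move=> _ [M [_ ->]]; apply: pd_extended_nat.
have natB : SB `<=` extended_nat by move=> _ [N [_ ->]]; apply: pd_extended_nat.
have supB N : Q N -> (pd N <= supremum 0 SB)%E.
  by move=> QN; apply: le_supremum_extended_nat => //; exists N.
have supB0 : (0 <= supremum 0 SB)%E.
  apply: Order.POrderTheory.le_trans (supB _ QN0).
  by apply: extended_nat_ge0; apply: pd_extended_nat.
apply: supremum_le_extended_nat => //; first by exists (pd M0), M0.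
move=> _ [M [PM ->]].
have [[-> _]|[n [-> nK _]]] := pdP K.
  by case: (supremum _ SB) supB0 => [s _|_|//]; exact: leey.
have [N QN NM] := PQ n nK M PM.
apply: Order.POrderTheory.le_trans (leeD2r _ (supB N QN)).
have [[-> _]|[k [-> kN _]]] := pdP N; first by rewrite leey.
rewrite -EFinD -PoszD addnC; exact/pd_le_pd/NM.
Qed.

Theorem corollary3p12 (A B : pzRingType) (phi : {rmorphism A -> B})
    (artA : left_artinian A) (artB : left_artinian B)
    (phiJ : radical_preserving phi) (kerphi : superfluous_kernel phi) :
  [/\ (fin_dim A <= fin_dim B + pd (right_restriction phi))%E,
      (Fin_dim A <= Fin_dim B + pd (right_restriction phi))%E &
      (gl_dim A <= gl_dim B + pd (right_restriction phi))%E].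
Proof.
have finite_pd R (M : lmodType R) : (pd M < +oo)%E <-> exists n, pd_le n M.
  have [[-> nM]|[n [-> nM _]]] := pdP M; last first.
    by rewrite ltry; split=> // _; exists n.
  by rewrite Order.POrderTheory.ltxx; split=> // -[n /nM].
have zero R : exists M : lmodType R, finitely_generated M /\ (pd M < +oo)%E.
  have [Z Z0] := ex_zero_module R; exists Z; split.
    by exists 0%N, (fun=> 0) => x; exists (fun=> 0); rewrite big_ord0 (Z0 x).
  by apply/finite_pd; exists 0%N; apply: projective_zero.
have transfer n : pd_le n (right_restriction phi) -> forall M : lmodType A,
    exists N : lmodType B, [/\ finitely_generated M -> finitely_generated N,
      (pd M < +oo)%E -> (pd N < +oo)%E & forall k, pd_le k N -> pd_le (n + k) M].
  move=> npd M; have bc := pd_le_base_change artA artB phiJ kerphi M npd.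
  exists (base_change_syzygy phi M n); split=> [||k /bc//].
    exact: finitely_generated_base_change_syzygy.
  move=> /finite_pd[m mM]; apply/finite_pd; exists m; apply/bc.
  by apply: pd_le_mono mM; apply: leq_addl.
have [ZA [fgA pdA]] := zero A; have [ZB [fgB pdB]] := zero B.
split.
- have split3 R : [set e | exists M : lmodType R,
      [/\ finitely_generated M, (pd M < +oo)%E & e = pd M]] =
    [set e | exists M : lmodType R,
      (finitely_generated M /\ (pd M < +oo)%E) /\ e = pd M].
    by apply/seteqP; split=> e [M]; [case=> ? ? ?|case=> -[? ?] ?]; exists M.
  rewrite /fin_dim !split3; apply: supremum_pd_le.
  + by exists ZA.
  + by exists ZB.
  + move=> n /transfer trans M [Mfg Mpd]; have [N [fg pdN kN]] := trans M.
    by exists N; auto.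
- apply: supremum_pd_le; [by exists ZA|by exists ZB|].
  move=> n /transfer trans M Mpd; have [N [_ pdN kN]] := trans M.
  by exists N; auto.
- have add_true R : [set e | exists M : lmodType R, e = pd M] =
    [set e | exists M : lmodType R, True /\ e = pd M].
    by apply/seteqP; split=> e [M]; [|case=> _]; exists M.
  rewrite /gl_dim !add_true; apply: supremum_pd_le; [by exists ZA|by exists ZB|].
  by move=> n /transfer trans M _; have [N [_ _ kN]] := trans M; exists N.
Qed.
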